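(* Let $y\in L^2(0,1)$ and let $(\lambda_k)_{k\ge0}$ be a nondecreasing sequence of positive numbers. For one-dimensional TV-denoising on $(0,1)$, the MHDM iterates coincide with the Tikhonov (TV-denoising) minimizers: $x_k=x_{\lambda_k}$ for all $k\in\mathbb N_0$.
   Context: $|u|_{TV}=\sup\{\int_0^1u\,\varphi'\,dt:\varphi\in C_c^\infty(0,1),\ \|\varphi\|_\infty\le1\}$ is the total variation seminorm on $L^2(0,1)$ (value $+\infty$ allowed). $x_\lambda$ is the unique minimizer in $L^2(0,1)$ of $x\mapsto\frac{\lambda}{2}\|x-y\|_{L^2}^2+|x|_{TV}$. MHDM: $x_0=x_{\lambda_0}$ and, for $k\ge1$, $x_k=\arg\min_{x\in L^2(0,1)}\frac{\lambda_k}{2}\|x-y\|_{L^2}^2+|x-x_{k-1}|_{TV}$ (unique). *)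

(* Defs.v *)
From HB Require Import structures.
From mathcomp Require Import all_boot all_order all_algebra.
From mathcomp Require Import all_classical all_reals all_analysis.
Set Implicit Arguments. Unset Strict Implicit. Unset Printing Implicit Defensive.
Import Order.TTheory GRing.Theory Num.Theory.
Import numFieldNormedType.Exports.
Local Open Scope classical_set_scope.
Local Open Scope ring_scope.

Section Defs.
Variable R : realType.

Definition I01 : set R := `]0%R, 1%R[.

Local Notation mu := (@lebesgue_measure R).

Definition inL2 (x : R -> R) : Prop :=
  measurable_fun I01 x /\ (\int[mu]_(t in I01) ((x t) ^+ 2)%:E < +oo)%E.

Definition L2norm2 (x : R -> R) : \bar R :=
  (\int[mu]_(t in I01) ((x t) ^+ 2)%:E)%E.

Definition smooth_cpt (phi : R -> R) : Prop :=
  (forall (n : nat) (t : R), derivable (derive1n n phi) t 1) /\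
  compact (closure [set t | phi t != 0]) /\
  closure [set t | phi t != 0] `<=` I01.

Definition TV (u : R -> R) : \bar R :=
  ereal_sup [set (\int[mu]_(t in I01) (u t * derive1 phi t)%:E)%E |
             phi in [set phi | smooth_cpt phi /\ forall t, `|phi t| <= 1]].

Definition tikh (lam : R) (y z x : R -> R) : \bar R :=
  ((lam / 2)%:E * L2norm2 (fun t => (x t - y t)%R) + TV (fun t => (x t - z t)%R))%E.

Definition is_minimizer (lam : R) (y z x : R -> R) : Prop :=
  inL2 x /\ forall w, inL2 w -> (tikh lam y z x <= tikh lam y z w)%E.

End Defs.

(* Main.v *)
Require Import Defs.
From HB Require Import structures.
From mathcomp Require Import all_boot all_order all_algebra.
From mathcomp Require Import all_classical all_reals all_analysis.
From mathcomp Require Import measurable_realfun ring lra zify.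
Set Implicit Arguments. Unset Strict Implicit. Unset Printing Implicit Defensive.
Import Order.TTheory GRing.Theory Num.Theory.
Import numFieldNormedType.Exports.
Local Open Scope classical_set_scope.
Local Open Scope ring_scope.

(** Minimality of [x] for [lam/2 |x-y|^2 + TV(x-z)] means that [v := lam (y-x)]
    satisfies [<v,w> <= TV(w)] for all [w] in L2 and [<v,x-z> = TV(x-z)]; since
    subgradients are monotone this determines [x].  Hence it suffices that the
    minimizer [x2] for [lam2 >= lam1] also satisfies
    [TV(x2-x1) <= <lam2 (y-x2), x2-x1>], [x1] being the minimizer for [lam1].
    This inequality passes to the limit when [y] is approximated in L2, which
    reduces it to step functions.  There [lam (y-x)] is the increment of a dual
    sequence [F] with values in [[-1,1]] (the taut string), and [x] can only
    increase where [F = -1] and only decrease where [F = 1].  A discrete maximum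
    principle gives [|F1/lam1 - F2/lam2| <= 1/lam1 - 1/lam2], so that wherever
    [F1] touches the constraint, [F2] touches it too and the jumps of [x1] and
    [x2] are ordered: every jump of [x2-x1] has the sign of [-F2].  Test
    functions in [C_c^oo] with prescribed values at the nodes are obtained by
    gluing smooth monotone steps of almost constant slope. *)

(** * The discrete dual problem *)

Section discrete.
Variable R : realType.
Implicit Types (y F : nat -> R) (a : R) (n : nat).

(** [a] stands for [1 / lam], up to the mesh factor: from dual values at the nodes this recovers the
    primal candidate on the cells. *)
Definition dres a y F (i : nat) : R := y i - a * (F i.+1 - F i).

(** Optimality system of discrete TV denoising on [n] cells: the jumps sit at the interior nodes
    [i.+1], decreasing only where [F] is [1] and increasing only where [F] is [-1]. The box
    constraint is asked at every index so that later bounds carry no side condition. *)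
Definition taut n a y F : Prop :=
  [/\ F 0%N = 0, F n = 0, forall i, `|F i| <= 1 &
   forall i, (i.+1 < n)%N ->
     (F i.+1 < 1 -> dres a y F i <= dres a y F i.+1) /\
     (-1 < F i.+1 -> dres a y F i.+1 <= dres a y F i)].

Lemma taut_opp n a y F : taut n a y F ->
  taut n a (fun i => - y i) (fun i => - F i).
Proof.
move=> [F0 Fn F1 Fx].
have dE i : dres a (fun i => - y i) (fun i => - F i) i = - dres a y F i.
  by rewrite /dres; ring.
split=> [||i|i ilt]; rewrite ?F0 ?Fn ?oppr0 ?normrN//.
have [Fl Fg] := Fx i ilt; rewrite !dE; split => h; rewrite lerN2.
  by apply: Fg; lra.
by apply: Fl; lra.
Qed.

(* If the maximum exceeded [a1 - a2], the complementarity conditions would make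
   [W] locally convex at the first index where it is attained. *)
Lemma taut_diff_le n a1 a2 y F1 F2 : 0 < a2 -> a2 <= a1 ->
  taut n a1 y F1 -> taut n a2 y F2 ->
  forall i, (i <= n)%N -> a1 * F1 i - a2 * F2 i <= a1 - a2.
Proof.
move=> a20 a12 [F10 F1n F1b F1x] [F20 F2n F2b F2x].
pose W i := a1 * F1 i - a2 * F2 i.
have [i0 _ i0max] := @arg_maxP _ _ _ (@ord0 n) predT (fun i : 'I_n.+1 => W i) isT.
have Wmax i : (i <= n)%N -> W i <= W i0.
  by rewrite -ltnS => lin; exact: (i0max (Ordinal lin)).
suff Wi0 : W i0 <= a1 - a2 by move=> i /Wmax Wi; exact: le_trans Wi Wi0.
rewrite leNgt; apply/negP => hW.
pose P k := (k <= n)%N && (W k == W i0).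
have exP : exists k, P k by exists i0; rewrite /P eqxx andbT -ltnS.
have [k /andP[kn /eqP Wk] kmin] := ex_minnP exP.
have W0 : W 0%N = 0 by rewrite /W F10 F20; ring.
have Wn : W n = 0 by rewrite /W F1n F2n; ring.
case: k kn Wk kmin => [|k] kn Wk kmin; first by rewrite -Wk W0 in hW; lra.
have kltn : (k.+1 < n)%N.
  rewrite ltn_neqAle kn andbT; apply/eqP => kE.
  by rewrite -Wk kE Wn in hW; lra.
have Wlt : W k < W i0.
  rewrite lt_neqAle Wmax ?andbT; last lia.
  apply/negP => h; have := kmin k; rewrite /P h ltnn andbT => /(_ _)/notF; apply; lia.
have Wle : W k.+2 <= W i0 by exact: Wmax.
have [+ _] := F2x k kltn; have [_ +] := F1x k kltn.
move: (F1b k.+1) (F2b k.+1); rewrite !ler_norml => /andP[b1 b2] /andP[b3 b4].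
(* A value of [W] above [a1 - a2] excludes both [F1 = -1] and [F2 = 1], so both one-sided conditions
   apply; their difference no longer contains [y] and says that the second difference of [W] at
   [k.+1] is nonnegative. *)
have hk : a1 - a2 < W k.+1 by rewrite Wk.
have h1 : -1 < F1 k.+1 by rewrite /W in hk; nra.
have h2 : F2 k.+1 < 1 by rewrite /W in hk; nra.
move=> /(_ h1) + /(_ h2); rewrite /dres => e1 e2.
by rewrite -Wk in Wlt Wle; rewrite /W in Wlt Wle; lra.
Qed.

Lemma taut_diff_ge n a1 a2 y F1 F2 : 0 < a2 -> a2 <= a1 ->
  taut n a1 y F1 -> taut n a2 y F2 ->
  forall i, (i <= n)%N -> a2 - a1 <= a1 * F1 i - a2 * F2 i.
Proof.
move=> a20 a12 /taut_opp t1 /taut_opp t2 i ilen.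
by have := taut_diff_le a20 a12 t1 t2 ilen; lra.
Qed.

(** Complementarity: a nonzero jump forces [F i.+1] to be [1] or [-1], with the sign opposite to the
    jump. Summed over the interior nodes, pairing with [- F] attains the discrete total
    variation. *)
Lemma taut_norm n a y F i : taut n a y F -> (i.+1 < n)%N ->
  `|dres a y F i.+1 - dres a y F i| =
    - (F i.+1 * (dres a y F i.+1 - dres a y F i)).
Proof.
move=> [_ _ F1 Fx] ilt; have [Fl Fg] := Fx i ilt.
move: (F1 i.+1); rewrite ler_norml => /andP[b1 b2].
have [F1e|Flt] := eqVneq (F i.+1) 1.
  by rewrite F1e ler0_norm ?mul1r// subr_le0; apply: Fg; lra.
have [Fm1|Fgt] := eqVneq (F i.+1) (-1).
  by rewrite Fm1 ger0_norm ?mulN1r ?opprK// subr_ge0; apply: Fl; lra.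
have -> : dres a y F i.+1 = dres a y F i.
  apply/eqP; rewrite eq_le Fg ?Fl// lt_neqAle ?Flt//.
  by rewrite eq_sym Fgt.
by rewrite subrr mulr0 normr0 oppr0.
Qed.

(** The jump of [x] is the second difference of [W = a1 * F1 - a2 * F2]. Where [F1] is [1] or [-1],
    [F2] must equal it and [W] reaches its extreme bound, which fixes the sign of the jump;
    elsewhere the first residual does not jump and [taut_norm] for [F2] applies. *)
Lemma taut_diff_norm n a1 a2 y F1 F2 i : 0 < a2 -> a2 <= a1 ->
  taut n a1 y F1 -> taut n a2 y F2 -> (i.+1 < n)%N ->
  let x i := dres a2 y F2 i - dres a1 y F1 i in
  `|x i.+1 - x i| = - (F2 i.+1 * (x i.+1 - x i)).
Proof.
move=> a20 a12 t1 t2 ilt.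
have Wl := taut_diff_le a20 a12 t1 t2; have Wg := taut_diff_ge a20 a12 t1 t2.
have N2 := taut_norm t2 ilt.
case: t1 t2 => [_ _ F1b F1x] [_ _ F2b _] /=.
have [Fl Fg] := F1x i ilt.
move: (F1b i.+1) (F2b i.+1); rewrite !ler_norml => /andP[b1 b2] /andP[b3 b4].
have i2 : (i.+1 <= n)%N by exact: ltnW.
have i1 : (i <= n)%N by exact: ltnW.
have [F1e|Flt] := eqVneq (F1 i.+1) 1.
  have F2e : F2 i.+1 = 1.
    by have := Wl _ i2; rewrite F1e => h; apply/eqP; rewrite eq_le b4 /=; nra.
  rewrite F2e ler0_norm ?mul1r// subr_le0.
  have := Wl _ i1; have := Wl _ ilt; rewrite /dres F1e F2e; lra.
have [Fm1|Fgt] := eqVneq (F1 i.+1) (-1).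
  have F2e : F2 i.+1 = -1.
    by have := Wg _ i2; rewrite Fm1 => h; apply/eqP; rewrite eq_le b3 andbT; nra.
  rewrite F2e ger0_norm ?mulN1r ?opprK// subr_ge0.
  have := Wg _ i1; have := Wg _ ilt; rewrite /dres Fm1 F2e; lra.
have e1 : dres a1 y F1 i.+1 = dres a1 y F1 i.
  apply/eqP; rewrite eq_le Fg ?Fl// lt_neqAle ?Flt//.
  by rewrite eq_sym Fgt.
have -> : dres a2 y F2 i.+1 - dres a1 y F1 i.+1 - (dres a2 y F2 i - dres a1 y F1 i) =
   dres a2 y F2 i.+1 - dres a2 y F2 i by rewrite e1; ring.
exact: N2.
Qed.

(** Only entries strictly between [0] and [n] are read: the zero boundary values are built in, and
    the minimization can run over a full box. *)
Let ext n (v : 'rV[R]_n.+1) (j : nat) : R :=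
  if (0 < j < n)%N then v ord0 (inord j) else 0.

(* [p] and [q] are the residuals on both sides of the perturbed node. *)
Lemma le_of_small_perturbation (p q a d : R) : 0 < a -> 0 < d ->
  (forall s, 0 < s -> s <= d ->
    p ^+ 2 + q ^+ 2 <= (p - a * s) ^+ 2 + (q + a * s) ^+ 2) ->
  p <= q.
Proof.
move=> a0 d0 h; rewrite leNgt; apply/negP => qp.
(* The hypothesis amounts to [p - q <= a * s], which fails once [a * s] is at most half of
   [p - q]. *)
pose s := Num.min d ((p - q) / (2 * a)).
have s0 : 0 < s.
  by rewrite lt_min d0 /= divr_gt0 ?subr_gt0 ?mulr_gt0.
have sd : s <= d by rewrite ge_min lexx.
have as_ : a * s <= (p - q) / 2.
  have : s <= (p - q) / (2 * a) by rewrite ge_min lexx orbT.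
  rewrite ler_pdivlMr ?mulr_gt0// => h1; lra.
have := h s s0 sd.
have : 0 < a * s by exact: mulr_gt0.
by move: as_; set w := a * s => ? ? ?; nra.
Qed.

(* The dual problem: the residual [dres a y F] has least norm among all [F] in the box. *)
Lemma taut_exists n a y : 0 < a -> exists F, taut n a y F.
Proof.
move=> a0.
pose A : set 'rV[R]_n.+1 := [set v | forall i, `[(-1), 1]%classic (v ord0 i)].
have cA : compact A.
  apply: (@rV_compact R n.+1 (fun=> `[(-1), 1]%classic)) => _.
  exact: segment_compact.
pose E (v : 'rV[R]_n.+1) := \sum_(i < n) (dres a y (ext v) i) ^+ 2.
have cext j : continuous (fun v : 'rV[R]_n.+1 => ext v j).
  rewrite /ext; case: (0 < j < n)%N; last exact: cst_continuous.
  exact: coord_continuous.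
have cE : continuous E.
  apply: continuous_big => [|i _ v]; first exact: add_continuous.
  have cd : {for v, continuous (fun w => dres a y (ext w) i)}.
    apply: continuousB; first exact: cst_continuous.
    apply: continuousM; first exact: cst_continuous.
    by apply: continuousB; exact: cext.
  exact: (@continuous_comp _ _ _ _ (@GRing.exp R ^~ 2%N) v cd
    (@exprn_continuous R 2%N _)).
have A0 : A !=set0.
  by exists 0 => i /=; rewrite mxE in_itv /= lerN10 ler01.
have [v /set_mem Av vmin] := compact_EVT_min A0 cA (continuous_subspaceT cE).
have extb w j : A w -> `|ext w j| <= 1.
  move=> Aw; rewrite /ext; case: ifP => _; last by rewrite normr0.
  by have /= := Aw (inord j); rewrite in_itv /= ler_norml.
exists (ext v); split.
- by rewrite /ext ltnn.
- by rewrite /ext ltnn andbF.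
- by move=> i; exact: extb.
move=> i iltn.
(* Moving the node [i.+1] by [s] changes only the two adjacent residuals, so all other terms of [E]
   cancel. *)
have pert s : A (v + s *: delta_mx ord0 (inord i.+1)) ->
    dres a y (ext v) i ^+ 2 + dres a y (ext v) i.+1 ^+ 2 <=
    (dres a y (ext v) i - a * s) ^+ 2 + (dres a y (ext v) i.+1 + a * s) ^+ 2.
  move=> /mem_set /vmin; rewrite /E; set w := v + _.
  have ew j : ext w j = ext v j + s * (j == i.+1)%:R.
    rewrite /ext; case: ifP => h.
      rewrite !mxE eqxx /= -(inj_eq val_inj) /= !inordK //; lia.
    rewrite (_ : (j == i.+1) = false) ?mulr0 ?addr0//; lia.
  have i1 : (i < n)%N by lia.
  rewrite (bigD1 (Ordinal i1))//= (bigD1 (Ordinal iltn))/=; last first.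
    by rewrite -(inj_eq val_inj) /=; lia.
  rewrite [leRHS](bigD1 (Ordinal i1))//= [X in _ <= _ + X](bigD1 (Ordinal iltn))/=; last first.
    by rewrite -(inj_eq val_inj) /=; lia.
  set S1 := \sum_(_ | _) _; set S2 := \sum_(_ | _) _.
  have -> : S2 = S1.
    apply: eq_bigr => j /andP[]; rewrite -!(inj_eq val_inj) /= => j1 j2.
    rewrite /dres !ew (_ : (j.+1 == i.+1) = false); last lia.
    rewrite (_ : (nat_of_ord j == i.+1) = false); last lia.
    by rewrite !mulr0 !addr0.
  have -> : dres a y (ext w) i = dres a y (ext v) i - a * s.
    rewrite /dres !ew eqxx (_ : (i == i.+1) = false); last lia.
    by rewrite /=; ring.
  have -> : dres a y (ext w) i.+1 = dres a y (ext v) i.+1 + a * s.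
    rewrite /dres !ew eqxx (_ : (i.+2 == i.+1) = false); last lia.
    by rewrite /=; ring.
  by rewrite !addrA lerD2r.
have vA s : -1 <= ext v i.+1 + s <= 1 -> A (v + s *: delta_mx ord0 (inord i.+1)).
  move=> hs j /=; rewrite !mxE eqxx /= in_itv /=.
  have [->|_] := eqVneq j (inord i.+1).
    by move: hs; rewrite /ext iltn /= mulr1.
  rewrite mulr0 addr0; by have := Av j; rewrite /= in_itv.
have vb : `|ext v i.+1| <= 1 by exact: extb.
move: vb; rewrite ler_norml => /andP[b1 b2].
split => h.
  apply: (@le_of_small_perturbation _ _ a (1 - ext v i.+1)) => // [|s s0 s1].
    by rewrite subr_gt0.
  by apply/pert/vA/andP; split; lra.
apply: (@le_of_small_perturbation _ _ a (1 + ext v i.+1)) => // [|s s0 s1].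
  by lra.
(* Moving the node down exchanges the roles of the two residuals. *)
have := pert (- s); rewrite !mulrN !opprK [X in X <= _]addrC [X in _ <= X]addrC.
by apply; apply/vA/andP; split; lra.
Qed.

End discrete.

(** * Smooth steps *)

Section smooth.
Variable R : realType.
Implicit Types f g h : R -> R.

Definition smooth f := forall n t, derivable (derive1n n f) t 1.

Lemma derive1_fun f g : (forall t : R, is_derive t 1 f (g t)) -> (derive1 f) = g.
Proof. by move=> fg; apply/funext => t; rewrite derive1E derive_val. Qed.

(** Spares formulas for n-th derivatives: for products, sums, affine substitutions and [flat] it
    suffices to exhibit a class of functions stable under one derivation. *)
Lemma smooth_coind (P : (R -> R) -> Prop) :
  (forall f, P f -> exists2 g, forall t : R, is_derive t 1 f (g t) & P g) ->
  forall f, P f -> smooth f.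
Proof.
move=> HP f Pf n; have : P (derive1n n f).
  elim: n => //= n /HP[g fg Pg].
  by rewrite (derive1_fun fg).
by move=> /HP[g fg _] t; have := fg t => -[].
Qed.

Lemma smooth_is_derive f : smooth f -> forall t : R, is_derive t 1 f ((derive1 f) t).
Proof. by move=> sf t; apply: DeriveDef; [exact: (sf 0%N)|rewrite derive1E]. Qed.

Lemma smooth_derive1 f : smooth f -> smooth (derive1 f).
Proof. by move=> sf n t; have := sf n.+1 t; rewrite /derive1n iterSr. Qed.

Lemma is_derive_smooth f g : (forall t : R, is_derive t 1 f (g t)) -> smooth g ->
  smooth f.
Proof.
move=> fg sg [|n] t; first by case: (fg t).
by rewrite /derive1n iterSr (derive1_fun fg); exact: sg.
Qed.

Lemma smooth_cst (c : R) : smooth (fun=> c).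
Proof.
apply: (@smooth_coind (fun f => exists c, f = fun=> c)); last by exists c.
move=> _ [d ->]; exists (fun=> 0); last by exists 0.
by move=> t; exact: is_derive_cst.
Qed.

(* The class of finite sums of products of two smooth functions is closed under derivation. *)
Lemma smoothM f g : smooth f -> smooth g -> smooth (fun t => f t * g t).
Proof.
move=> sf sg.
pose P h := exists s : seq ((R -> R) * (R -> R)),
  (forall p, List.In p s -> smooth p.1 /\ smooth p.2) /\
  h = (fun t => \sum_(p <- s) p.1 t * p.2 t).
apply: (@smooth_coind P); last first.
  exists [:: (f, g)]; split => [p [<-|[]]|]; first by split; assumption.
  by apply/funext => t; rewrite big_seq1.
move=> _ [s [hs ->]].
elim: s hs => [|[p q] s IH] hs.
  exists (fun=> 0); last by exists [::]; split => //; apply/funext => t; rewrite big_nil.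
  move=> t; under eq_fun do rewrite big_nil.
  exact: is_derive_cst.
have [sp sq] := hs (p, q) (or_introl erefl).
have [k hk [s' [hs' kE]]] := IH (fun r rs => hs r (or_intror rs)).
exists (fun t => ((derive1 p) t * q t + p t * (derive1 q) t) + k t).
  move=> t; under eq_fun do rewrite big_cons /=.
  have dp := smooth_is_derive sp t; have dq := smooth_is_derive sq t.
  have hkt := hk t.
  apply: is_derive_eq; congr (_ + _).
  by rewrite /GRing.scale /=; ring.
exists [:: ((derive1 p), q), (p, (derive1 q)) & s']; split.
  move=> r /= [<-|[<-|]] /=; last exact: hs'.
    by split; [exact: smooth_derive1|exact: sq].
  by split; [exact: sp|exact: smooth_derive1].
by apply/funext => t; rewrite !big_cons /= kE addrA.
Qed.

Lemma smoothD f g : smooth f -> smooth g -> smooth (fun t => f t + g t).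
Proof.
move=> sf sg; pose P h := exists f g, [/\ smooth f, smooth g & h = fun t => f t + g t].
apply: (@smooth_coind P); last by exists f, g.
move=> _ [p [q [sp sq ->]]]; exists (fun t => (derive1 p) t + (derive1 q) t).
  move=> t; have dp := smooth_is_derive sp t; have dq := smooth_is_derive sq t.
  exact: is_deriveD.
by exists (derive1 p), (derive1 q); split; [exact: smooth_derive1..|].
Qed.

Lemma smooth_sum n (F : nat -> R -> R) : (forall i, smooth (F i)) ->
  smooth (fun t => \sum_(i < n) F i t).
Proof.
move=> sF; elim: n => [|n IH].
  by under eq_fun do rewrite big_ord0; exact: smooth_cst.
under eq_fun do rewrite big_ord_recr /=.
by apply: smoothD; [exact: IH|exact: sF].
Qed.

Lemma is_derive_affine f (a b d t : R) : is_derive (a * t + b) 1 f d ->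
  is_derive t 1 (fun t => f (a * t + b)) (a * d).
Proof.
move=> fd.
have dg : is_derive t 1 (fun t => a * t + b) a.
  apply: is_derive_eq; rewrite /GRing.scale /=; ring.
rewrite mulrC; exact: (@is_derive1_comp _ f (fun t => a * t + b)).
Qed.

Lemma smooth_affine f (a b : R) : smooth f -> smooth (fun t => f (a * t + b)).
Proof.
move=> sf; pose P h := exists g (c : R), smooth g /\ h = fun t => c * g (a * t + b).
apply: (@smooth_coind P); last first.
  by exists f, 1; split => //; apply/funext => t; rewrite mul1r.
move=> _ [g [c [sg ->]]]; exists (fun t => c * a * (derive1 g) (a * t + b)).
  move=> t; have /is_derive_affine dg := smooth_is_derive sg (a * t + b).
  rewrite -mulrA; exact: (is_deriveZ c).
by exists (derive1 g), (c * a); split; [exact: smooth_derive1|].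
Qed.

Lemma expn_expN_bounded n (u : R) : 0 <= u -> u ^+ n * expR (- u) <= n`!%:R.
Proof.
move=> u0; case: n => [|n].
  by rewrite expr0 mul1r -expR0 ler_expR oppr_le0.
rewrite expRN ler_pdivrMr ?expR_gt0// mulrC -ler_pdivrMr ?ltr0n ?fact_gt0//.
by apply: le_trans (expR_ge1Dxn n u0); rewrite lerDr.
Qed.

Lemma poly_expN_bounded (p : {poly R}) :
  exists C : R, forall u : R, 0 <= u -> `|p.[u] * expR (- u)| <= C.
Proof.
exists (\sum_(i < size p) `|p`_i| * i`!%:R) => u u0.
rewrite horner_coef mulr_suml (le_trans (ler_norm_sum _ _ _))// ler_sum// => i _.
rewrite -mulrA normrM ler_wpM2l// ger0_norm; first exact: expn_expN_bounded.
by rewrite mulr_ge0 ?expR_ge0 ?exprn_ge0.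
Qed.

(** The classical flat function exp(-1/t), with a polynomial in 1/t in front so that the family is
    stable under derivation. *)
Definition flat (p : {poly R}) (t : R) : R :=
  if 0 < t then p.[t^-1] * expR (- t^-1) else 0.

Lemma is_derive_flat (p : {poly R}) (t : R) :
  is_derive t 1 (flat p) (flat ('X^2 * (p - p^`())) t).
Proof.
have [t0|t0|->] := ltgtP t 0.
- rewrite [flat _ t]/flat ltNge (ltW t0) /=.
  apply: (@near_eq_is_derive R R R (fun=> 0)).
  near=> s; rewrite /flat ltNge (_ : s <= 0)//; apply: ltW.
  by near: s; exact: lt_nbhsl.
- rewrite [flat _ t]/flat t0.
  apply: (@near_eq_is_derive R R R (fun t => p.[t^-1] * expR (- t^-1))).
    near=> s; rewrite /flat (_ : 0 < s)//.
    by near: s; exact: lt_nbhsr.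
  have tn0 : t != 0 by rewrite gt_eqF.
  have dV : is_derive t 1 (fun t : R => t^-1) (- t ^- 2).
    apply: DeriveDef; first exact: derivableV.
    by rewrite deriveV// derive_id /GRing.scale /= mulr1.
  have d1 : is_derive t 1 (fun t => p.[t^-1]) (p^`().[t^-1] * - t ^- 2).
    exact: (@is_derive1_comp _ (horner p) (fun t => t^-1)).
  have d2 : is_derive t 1 (fun t => - t^-1) (t ^- 2).
    by apply: is_derive_eq; rewrite opprK.
  have d3 : is_derive t 1 (fun t => expR (- t^-1)) (expR (- t^-1) * t ^- 2).
    exact: (@is_derive1_comp _ expR (fun t => - t^-1)).
  apply: is_derive_eq; rewrite /GRing.scale /= !hornerE /= exprVn; ring.
- have -> : flat ('X^2 * (p - p^`())) 0 = 0 by rewrite /flat ltxx.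
  (* With [u = 1/s], boundedness of [p(u) u^2 exp(-u)] gives a quadratic bound on [flat p] at [0],
     hence a zero derivative there. *)
  have [C hC] := poly_expN_bounded (p * 'X^2).
  have C0 : 0 <= C by apply: le_trans (hC 0 _).
  have hf s : `|flat p s| <= C * s ^+ 2.
    rewrite /flat; case: ifPn => [s0|_]; last by rewrite normr0 mulr_ge0 ?sqr_ge0.
    have := hC s^-1; rewrite invr_ge0 (ltW s0) => /(_ isT).
    rewrite hornerM hornerXn -mulrA (mulrC (_ ^+ 2)) mulrA normrM.
    rewrite [X in _ * X]ger0_norm ?sqr_ge0// exprVn ler_pdivrMr//.
    by rewrite exprn_gt0.
  have cv : (fun h : R => h^-1 *: ((flat p \o shift 0) (h *: (1:R)) - flat p 0))
      @ 0^' --> (0 : R).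
    apply/cvgr0Pnorm_le => e e0.
    near=> h; rewrite /= addr0 /GRing.scale /= mulr1.
    rewrite [flat p 0]/flat ltxx subr0 normrM normfV.
    have h0 : 0 < `|h| by rewrite normr_gt0; near: h; exact: nbhs_dnbhs_neq.
    rewrite mulrC ler_pdivrMr// (le_trans (hf h))//.
    rewrite -[h ^+ 2]real_normK ?num_real// expr2 mulrA ler_wpM2r//.
    have : `|h| < e / (C + 1).
      by near: h; apply: dnbhs0_lt; rewrite divr_gt0// ltr_wpDl.
    rewrite ltr_pdivlMr ?ltr_wpDl// => hlt.
    by apply: le_trans (ltW hlt); rewrite mulrC ler_wpM2l// lerDl.
  by apply: DeriveDef; [apply/cvg_ex; exists 0|exact/cvg_lim].
Unshelve. all: by end_near. Qed.

Lemma smooth_flat p : smooth (flat p).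
Proof.
apply: (@smooth_coind (fun f => exists p, f = flat p)); last by exists p.
move=> _ [q ->]; exists (flat ('X^2 * (q - q^`()))); last by eexists.
by move=> t; exact: is_derive_flat.
Qed.

End smooth.

(** * Monotone smooth steps of almost constant slope *)

Section smooth_step.
Variable R : realType.
Implicit Types f g h : R -> R.

Lemma is_derive_continuous f g : (forall t : R, is_derive t 1 f (g t)) ->
  continuous f.
Proof.
move=> fg t; apply/differentiable_continuous/derivable1_diffP.
by case: (fg t).
Qed.

Lemma smooth_continuous f : smooth f -> continuous f.
Proof. by move=> /smooth_is_derive/is_derive_continuous. Qed.

Lemma increment_mean_value f g (a b : R) :
  (forall t : R, is_derive t 1 f (g t)) -> a <= b ->
  exists2 c, a <= c <= b & f b - f a = g c * (b - a).
Proof.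
move=> fg ab.
have [|c] := MVT_segment ab (fun x _ => fg x); last by rewrite in_itv; exists c.
exact/continuous_subspaceT/(is_derive_continuous fg).
Qed.

Lemma antiderivative f : continuous f -> (forall t, t <= 0 -> f t = 0) ->
  exists2 F, forall t : R, is_derive t 1 F (f t) & forall t, t <= 0 -> F t = 0.
Proof.
move=> cf f0.
(* The base point [-1] lies where [f] vanishes: the fundamental theorem covers every [t > -1],
   including [0], and near all other points [F] is zero. *)
pose F x := \int[lebesgue_measure]_(t in `[(-1), x]) f t.
have F0 t : t <= 0 -> F t = 0.
  move=> t0; rewrite /F (@eq_Rintegral _ _ _ _ _ (fun=> 0)) ?Rintegral0//.
    by rewrite /Rintegral integral0.
  by move=> s; rewrite inE /= in_itv /= => /andP[_ st]; rewrite f0// (le_trans st).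
exists F => // t; have [t1|t1] := ltP (-1) t.
  have [||dF F'] := @continuous_FTC1_closed R f (-1) t (t + 1) _ _ t1 (cf t).
  - by rewrite ltrDl.
  - apply: continuous_compact_integrable; first exact: segment_compact.
    exact: continuous_subspaceT.
  by apply: DeriveDef; [exact: dF|rewrite -derive1E].
have t0 : t < 0 by rewrite (le_lt_trans t1)// oppr_lt0.
rewrite f0 ?(ltW t0)//; apply: (@near_eq_is_derive R R R (fun=> 0)).
near=> s; rewrite F0//; apply: ltW.
by near: s; exact: lt_nbhsl.
Unshelve. all: by end_near. Qed.

Let psi := @flat R 1.

Let psiE s : psi s = if 0 < s then expR (- s^-1) else 0.
Proof. by rewrite /psi /flat hornerC mul1r. Qed.

Let psi_ge0 s : 0 <= psi s.
Proof. by rewrite psiE; case: ifP => // _; exact: expR_ge0. Qed.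

Let psi_le1 s : psi s <= 1.
Proof.
rewrite psiE; case: ifP => // s0.
by rewrite -expR0 ler_expR oppr_le0 invr_ge0 ltW.
Qed.

Let psi_large d s : 0 < d -> d^-1 <= s -> 1 - d <= psi s.
Proof.
move=> d0 ds; have s0 : 0 < s by rewrite (lt_le_trans _ ds)// invr_gt0.
rewrite psiE s0; apply: le_trans (expR_ge1Dx _); rewrite lerD2l lerN2.
by rewrite -[leRHS]invrK lef_pV2// ?posrE// invr_gt0.
Qed.

(** [S] is the normalized antiderivative of a plateau [p] with values in [[0, 1]], zero near [0] and
    [1] and almost [1] in between. Its integral is then at least [1 / (1 + e)], which bounds the
    slope by [1 + e]. *)
Lemma smooth_step (e : R) : 0 < e -> exists S d, [/\ 0 < d, smooth S,
  forall t, t <= d -> S t = 0, forall t, 1 - d <= t -> S t = 1 &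
  forall t, 0 <= derive1 S t <= 1 + e].
Proof.
move=> e0.
(* The integral of the plateau will be at least [1 - 4 * d], and this [d] gives
   [(1 - 4 * d) * (1 + e) >= 1]. *)
pose d := e / (8 * (1 + e)).
have e1 : 0 < 1 + e by rewrite addr_gt0.
have d0 : 0 < d by rewrite divr_gt0// mulr_gt0.
have dE : d * (8 * (1 + e)) = e.
  by rewrite divfK// mulf_neq0// ?gt_eqF.
have d1 : d < 1 / 8 by nra.
(* On [[d, 1 - d]] both arguments of [psi] in [p] are at least [k * d - 1 = d^-1], so [psi_large]
   bounds each factor below by [1 - d]. *)
pose k := (d^-1 + 1) / d.
have kd : k * d = d^-1 + 1 by rewrite /k divfK// gt_eqF.
have dV : 8 < d^-1 by rewrite -[X in X < _]invrK ltf_pV2 ?posrE//; lra.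
have k2 : 2 < k by nra.
have k0 : 0 < k by lra.
pose p t := psi (k * t + -1) * psi ((- k) * t + (k - 1)).
have sp : smooth p.
  by apply: smoothM; apply: smooth_affine; exact: smooth_flat.
have p_ge0 t : 0 <= p t by exact: mulr_ge0.
have p_le1 t : p t <= 1 by rewrite mulr_ile1.
have kVE : k * k^-1 = 1 by rewrite divff// gt_eqF.
have pl t : t <= k^-1 -> p t = 0.
  move=> tk; rewrite /p [psi (k * t + -1)]psiE ltNge.
  rewrite (_ : k * t + -1 <= 0) ?mul0r//.
  by have := ler_wpM2l (ltW k0) tk; rewrite kVE; lra.
have pr t : 1 - k^-1 <= t -> p t = 0.
  move=> tk; rewrite /p [psi (_ + (k - 1))]psiE ltNge.
  rewrite (_ : _ + _ <= 0) ?mulr0//.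
  by have := ler_wpM2l (ltW k0) tk; rewrite mulrBr kVE; lra.
have kV0 : 0 < k^-1 by rewrite invr_gt0.
have kV2 : k^-1 < 1/2 by nra.
have [P dP P0] := antiderivative (smooth_continuous sp)
  (fun t t0 => pl t (le_trans t0 (ltW kV0))).
have Pmono a b : a <= b -> P a <= P b.
  move=> ab; have [c _ Pc] := increment_mean_value dP ab.
  by rewrite -subr_ge0 Pc mulr_ge0// subr_ge0.
have P1 : 1 <= P 1 * (1 + e).
  have dd : d <= 1 - d by lra.
  have [c /andP[c1 c2] Pc] := increment_mean_value dP dd.
  have pc : (1 - d) * (1 - d) <= p c.
    apply: ler_pM; rewrite ?subr_ge0; try lra.
      by apply: psi_large => //; have := ler_wpM2l (ltW k0) c1; rewrite kd; lra.
    by apply: psi_large => //; have := ler_wpM2l (ltW k0) c2; rewrite mulrBr kd; lra.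
  have Pd : P d >= 0 by rewrite -(P0 0)// Pmono// ltW.
  have Pd1 : P (1 - d) <= P 1 by apply: Pmono; lra.
  have h1 : (1 - d) * (1 - d) * (1 - d - d) <= P 1.
    apply: le_trans (_ : P (1 - d) - P d <= _); last lra.
    by rewrite Pc ler_wpM2r//; lra.
  have h2 : 1 - 4 * d <= (1 - d) * (1 - d) * (1 - d - d) by nra.
  have : (1 - 4 * d) * (1 + e) <= P 1 * (1 + e).
    by rewrite ler_wpM2r ?(le_trans h2)// ltW.
  lra.
have P10 : 0 < P 1 by nra.
(* The margin returned is [k^-1], the width on which [p] vanishes, and not the auxiliary [d]. *)
exists (fun t => (P 1)^-1 * P t), k^-1.
have dS (t : R) : is_derive t 1 (fun t => (P 1)^-1 * P t) ((P 1)^-1 * p t).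
  by have dPt := dP t; exact: (is_deriveZ (P 1)^-1).
split.
- exact: kV0.
- by apply: is_derive_smooth dS _; apply: smoothM; [exact: smooth_cst|exact: sp].
- move=> t tk /=; have [t0|/ltW t0] := leP t 0; first by rewrite (P0 t)// mulr0.
  have [c /andP[c1 c2]] := increment_mean_value dP t0.
  by rewrite (P0 0)// subr0 pl ?mul0r ?(le_trans c2)// => ->; rewrite mulr0.
- move=> t kt /=; suff -> : P t = P 1 by rewrite mulVf// gt_eqF.
  have [t1|/ltW t1] := leP t 1.
    have [c /andP[c1 c2]] := increment_mean_value dP t1.
    by rewrite pr ?mul0r ?(le_trans kt)// => /eqP; rewrite subr_eq0 => /eqP.
  have [c /andP[c1 c2]] := increment_mean_value dP t1.
  rewrite pr ?mul0r; first by move=> /eqP; rewrite subr_eq0 => /eqP.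
  lra.
- move=> t; rewrite (derive1_fun dS) mulr_ge0 ?invr_ge0 ?(ltW P10)//=.
  rewrite mulrC ler_pdivrMr// mulrC; apply: le_trans (p_le1 t) _.
  by rewrite mulrC in P1; rewrite mulrC.
Qed.

End smooth_step.

(** * Smooth interpolation of values prescribed at the nodes *)

Section interpolation.
Variable R : realType.

Lemma sum_by_parts (F b : nat -> R) n :
  \sum_(i < n) (F i.+1 - F i) * b i =
  F n * b n - F 0%N * b 0%N + \sum_(i < n) F i.+1 * (b i - b i.+1).
Proof.
elim: n => [|n IH]; first by rewrite !big_ord0; ring.
by rewrite !big_ord_recr /= IH; ring.
Qed.

(** Summation by parts turns the sum into a combination of values of [F] whose weights [b n] and
    [b i - b i.+1] are nonnegative and add up to [b 0]. It keeps the interpolant within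
    [[-1, 1]]. *)
Lemma sum_decreasing_weights (F b : nat -> R) n : F 0%N = 0 ->
  (forall i, `|F i| <= 1) -> (forall i, b i.+1 <= b i) -> 0 <= b n ->
  `|\sum_(i < n) (F i.+1 - F i) * b i| <= b 0%N.
Proof.
move=> F0 F1 bd bn; rewrite sum_by_parts F0 mul0r subr0.
apply: (@le_trans _ _ (b n + \sum_(i < n) (b i - b i.+1))).
  apply: le_trans (ler_normD _ _) _; apply: lerD.
    by rewrite normrM (ger0_norm bn) ler_piMl.
  apply: le_trans (ler_norm_sum _ _ _) _; apply: ler_sum => i _.
  by rewrite normrM [X in _ * X]ger0_norm ?subr_ge0// ler_piMl// subr_ge0.
suff -> : \sum_(i < n) (b i - b i.+1) = b 0%N - b n by rewrite addrC subrK.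
clear bn; elim: n => [|n IH]; first by rewrite big_ord0 subrr.
by rewrite big_ord_recr /= IH; ring.
Qed.

Lemma telescope_indicator (F : nat -> R) n j : F 0%N = 0 ->
  \sum_(i < n) (F i.+1 - F i) * (i < j)%N%:R = F (minn n j).
Proof.
move=> F0; elim: n => [|n IH]; first by rewrite big_ord0 min0n F0.
rewrite big_ord_recr /= IH; have [nj|jn] := ltnP n j.
  by rewrite (minn_idPl nj) mulr1 addrC subrK.
rewrite mulr0 addr0; congr F; lia.
Qed.

(** The increments of [F] are switched on one cell after another. On cell [i] only the [i]-th step
    moves, with slope close to [n * (F i.+1 - F i)]. *)
Definition smooth_interp (S : R -> R) (F : nat -> R) n (t : R) : R :=
  \sum_(i < n) (F i.+1 - F i) * S (n%:R * t - i%:R).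

Variables (S : R -> R) (d : R) (F : nat -> R) (n : nat).
Hypotheses (d0 : 0 < d) (sS : smooth S) (S0 : forall t, t <= d -> S t = 0).
Hypotheses (S1 : forall t, 1 - d <= t -> S t = 1).
Hypothesis (dS0 : forall t, 0 <= derive1 S t).
Hypotheses (n0 : (0 < n)%N) (F0 : F 0%N = 0) (Fn : F n = 0).
Hypothesis (F1 : forall i, `|F i| <= 1).

Let Smono a b : a <= b -> S a <= S b.
Proof.
move=> ab; have [c _ Sc] := increment_mean_value (smooth_is_derive sS) ab.
by rewrite -subr_ge0 Sc mulr_ge0// subr_ge0.
Qed.

Let S_ge0 t : 0 <= S t.
Proof.
by rewrite -(@S0 (Num.min t d)) ?ge_min ?lexx ?orbT// Smono// ge_min lexx.
Qed.

Let S_le1 t : S t <= 1.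
Proof.
by rewrite -(@S1 (Num.max t (1 - d))) ?le_max ?lexx ?orbT// Smono// le_max lexx.
Qed.

Let nR0 : 0 < n%:R :> R. Proof. by rewrite ltr0n. Qed.

Lemma smooth_interp_smooth : smooth (smooth_interp S F n).
Proof.
apply: (@smooth_sum _ _ (fun i t => (F i.+1 - F i) * S (n%:R * t - i%:R))) => i.
by apply: smoothM; [exact: smooth_cst|exact: smooth_affine].
Qed.

Lemma smooth_interp_le1 t : `|smooth_interp S F n t| <= 1.
Proof.
apply: le_trans (sum_decreasing_weights
  (b := fun i => S (n%:R * t - i%:R)) _ _ _ _) _ => //.
by move=> i; apply: Smono; rewrite lerD2l lerN2 ler_nat.
Qed.

Lemma smooth_interp_node i : (i <= n)%N -> smooth_interp S F n (i%:R / n%:R) = F i.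
Proof.
move=> ilen; rewrite /smooth_interp mulrCA divff ?gt_eqF// mulr1.
rewrite -[in RHS](minn_idPr ilen) -telescope_indicator//.
apply: eq_bigr => j _; congr (_ * _); have [ji|ij] := ltnP j i.
  rewrite S1// -natrB ?(ltnW ji)//.
  apply: (@le_trans _ _ 1); first by rewrite gerBl ltW.
  by rewrite ler1n subn_gt0.
by rewrite S0// (le_trans _ (ltW d0))// subr_le0 ler_nat.
Qed.

Lemma derive1_smooth_interp t : derive1 (smooth_interp S F n) t =
  \sum_(i < n) (F i.+1 - F i) * (n%:R * derive1 S (n%:R * t - i%:R)).
Proof.
rewrite /smooth_interp derive1E; apply: derive_val.
have H i : is_derive t 1 (fun t => (F i.+1 - F i) * S (n%:R * t - i%:R))
   ((F i.+1 - F i) * (n%:R * derive1 S (n%:R * t - i%:R))).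
  apply: (is_deriveZ (F i.+1 - F i)); apply: is_derive_affine.
  exact: smooth_is_derive.
pose g (i : 'I_n) t := (F i.+1 - F i) * S (n%:R * t - i%:R).
have := @is_derive_sum R R R n g t 1 _ (fun i => H i).
rewrite [X in is_derive _ _ X _](_ : _ = fun t => \sum_(i < n) g i t)//.
by apply/funext => s; rewrite fct_sumE.
Qed.

Lemma smooth_interp_cpt : smooth_cpt (smooth_interp S F n).
Proof.
have sub : closure [set t | smooth_interp S F n t != 0] `<=`
    `[d / n%:R, 1 - d / n%:R].
  rewrite closureE; apply: smallest_sub; first exact: interval_closed.
  move=> t /= /eqP h; rewrite in_itv /=; apply/andP.
  split; rewrite leNgt; apply/negP => ht; apply: h.
    rewrite /smooth_interp big1// => i _; rewrite S0 ?mulr0//.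
    move: ht; rewrite ltr_pdivlMr// mulrC => /ltW ht.
    by rewrite (le_trans _ ht)// gerBl.
  (* Near [1] all steps have reached the value [1], so the sum telescopes to [F n = 0]. *)
  transitivity (\sum_(i < n) (F i.+1 - F i) * (i < n)%N%:R).
    apply: eq_bigr => i _; congr (_ * _); rewrite ltn_ord S1//.
    have : 1 <= n%:R - i%:R :> R.
      by rewrite -natrB ?(ltnW (ltn_ord i))// ler1n subn_gt0 ltn_ord.
    move: ht; rewrite ltrBlDr -ltrBlDl => ht.
    have : n%:R - n%:R * t <= d.
      have : 1 - t < d / n%:R by lra.
      by rewrite ltr_pdivlMr// mulrBl mul1r (mulrC t) => /ltW.
    by lra.
  by rewrite telescope_indicator// minnn.
split; first exact: smooth_interp_smooth.
split.
  exact: (subclosed_compact (@closed_closure _ _) (@segment_compact _ _ _) sub).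
apply: subset_trans sub _ => t /=; rewrite /I01 /= !in_itv /= => /andP[t1 t2].
have dn : 0 < d / n%:R by rewrite divr_gt0.
by rewrite (lt_le_trans dn t1) (le_lt_trans t2)// gtrBl.
Qed.

End interpolation.

(** * The inner product of L2(0,1) *)

Section L2.
Variable R : realType.
Implicit Types (u v w : R -> R) (c : R).
Local Notation mu := (@lebesgue_measure R).

Lemma measurable_I01 : measurable (@I01 R).
Proof. exact: measurable_itv. Qed.
#[local] Hint Resolve measurable_I01 : core.

Lemma lebesgue_I01 : mu (@I01 R) = 1%:E.
Proof. by rewrite /I01 lebesgue_measure_itv /= lte_fin ltr01 oppr0 adde0. Qed.

Lemma inL2P u : inL2 u <-> measurable_fun (@I01 R) u /\
  mu.-integrable (@I01 R) (EFin \o (fun t => u t ^+ 2)).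
Proof.
split=> [[mu_ ufin]|[mu_ /integrableP[_ ufin]]]; split=> //.
  apply/integrableP; split.
    by apply/measurable_EFinP; exact: measurable_funX.
  by under eq_integral do rewrite /= ger0_norm ?sqr_ge0//.
by under eq_integral do rewrite /= -[X in X%:E]ger0_norm ?sqr_ge0//.
Qed.

Lemma inL2_le u v : measurable_fun (@I01 R) u -> inL2 v ->
  (forall t, I01 t -> `|u t| <= `|v t|) -> inL2 u.
Proof.
move=> mu_ /inL2P[_ iv] uv; apply/inL2P; split => //.
apply: le_integrable iv => //.
  by apply/measurable_EFinP; exact: measurable_funX.
move=> t It /=; rewrite lee_fin !normrX.
by rewrite lerXn2r ?nnegrE// uv.
Qed.

Lemma inL2_bounded u c : measurable_fun (@I01 R) u ->
  (forall t, I01 t -> `|u t| <= c) -> inL2 u.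
Proof.
move=> mu_ uc; apply: (@inL2_le _ (fun=> `|c|)) => // [|t It].
  apply/inL2P; split=> //; apply/integrableP; split.
    by apply/measurable_EFinP.
  under eq_integral do rewrite /= ger0_norm ?sqr_ge0//.
  by rewrite integral_cst//= lebesgue_I01 mule1 ltry.
by rewrite normr_id (le_trans (uc _ It))// ler_norm.
Qed.

Lemma inL2D u v : inL2 u -> inL2 v -> inL2 (u \+ v).
Proof.
move=> /inL2P[mu_ iu] /inL2P[mv iv]; apply/inL2P; split.
  exact: measurable_funD.
have iuv : mu.-integrable (@I01 R)
    (fun t => 2%:E * ((u t ^+ 2)%:E + (v t ^+ 2)%:E))%E.
  by apply: integrableZl => //; exact: integrableD.
apply: le_integrable iuv => //.
  apply/measurable_EFinP; apply: measurable_funX; exact: measurable_funD.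
move=> t It /=; rewrite lee_fin ger0_norm ?sqr_ge0// ger0_norm; last first.
  by rewrite mulr_ge0// addr_ge0// sqr_ge0.
by have := sqr_ge0 (u t - v t); nra.
Qed.

Lemma inL2Z c u : inL2 u -> inL2 (c \*o u).
Proof.
move=> /inL2P[mu_ iu]; apply/inL2P; split.
  by apply: measurable_funM => //; exact: measurable_cst.
have : mu.-integrable (@I01 R) (fun t => (c ^+ 2)%:E * (u t ^+ 2)%:E)%E.
  exact: integrableZl.
by under eq_fun do rewrite /= -EFinM -exprMn.
Qed.

Lemma inL2B u v : inL2 u -> inL2 v -> inL2 (u \- v).
Proof.
move=> iu iv; rewrite (_ : u \- v = u \+ (-1 \*o v)).
  by apply: inL2D => //; exact: inL2Z.
by apply/funext => t /=; rewrite mulN1r.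
Qed.

Lemma inL2_0 : inL2 (fun=> 0 : R).
Proof. by apply: (@inL2_bounded _ 0) => // t _; rewrite normr0. Qed.

Lemma inL2_sum n (F : nat -> R -> R) : (forall i, inL2 (F i)) ->
  inL2 (fun t => \sum_(i < n) F i t).
Proof.
move=> iF; elim: n => [|n IH].
  by under eq_fun do rewrite big_ord0; exact: inL2_0.
by under eq_fun do rewrite big_ord_recr /=; exact: inL2D.
Qed.

Lemma inL2_mul_integrable u v : inL2 u -> inL2 v ->
  mu.-integrable (@I01 R) (EFin \o (fun t => u t * v t)).
Proof.
move=> /inL2P[mu_ iu] /inL2P[mv iv].
have iuv : mu.-integrable (@I01 R) (fun t => (u t ^+ 2)%:E + (v t ^+ 2)%:E)%E.
  exact: integrableD.
apply: le_integrable iuv => //.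
  by apply/measurable_EFinP; exact: measurable_funM.
move=> t It /=; rewrite lee_fin [leRHS]ger0_norm ?addr_ge0 ?sqr_ge0//.
rewrite ler_norml; apply/andP; split.
  by have := sqr_ge0 (u t + v t); nra.
by have := sqr_ge0 (u t - v t); nra.
Qed.

(** The real-valued integral defaults to [0] when the extended one is infinite, hence the [inL2]
    hypotheses in the linearity lemmas. *)
Definition ip u v : R := \int[mu]_(t in @I01 R) (u t * v t).

Lemma ipC u v : ip u v = ip v u.
Proof. by apply: eq_Rintegral => t _; rewrite mulrC. Qed.

Lemma ipE u v : inL2 u -> inL2 v ->
  (\int[mu]_(t in @I01 R) (u t * v t)%:E)%E = (ip u v)%:E.
Proof.
move=> iu iv; rewrite fineK//.
by apply: integrable_fin_num => //; exact: inL2_mul_integrable.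
Qed.

Lemma L2norm2E u : inL2 u -> L2norm2 u = (ip u u)%:E.
Proof. by move=> iu; rewrite -ipE. Qed.

Lemma ipDl u v w : inL2 u -> inL2 v -> inL2 w -> ip (u \+ v) w = ip u w + ip v w.
Proof.
move=> iu iv iw; rewrite -RintegralD//; last 2 first.
- exact: inL2_mul_integrable.
- exact: inL2_mul_integrable.
by apply: eq_Rintegral => t _; rewrite mulrDl.
Qed.

Lemma ipBl u v w : inL2 u -> inL2 v -> inL2 w -> ip (u \- v) w = ip u w - ip v w.
Proof.
move=> iu iv iw; rewrite -RintegralB//; last 2 first.
- exact: inL2_mul_integrable.
- exact: inL2_mul_integrable.
by apply: eq_Rintegral => t _; rewrite mulrBl.
Qed.

Lemma ipZl c u w : inL2 u -> inL2 w -> ip (c \*o u) w = c * ip u w.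
Proof.
move=> iu iw; rewrite -RintegralZl//; last exact: inL2_mul_integrable.
by apply: eq_Rintegral => t _; rewrite /= mulrA.
Qed.

Lemma ipDr u v w : inL2 u -> inL2 v -> inL2 w -> ip w (u \+ v) = ip w u + ip w v.
Proof. by move=> *; rewrite ipC ipDl// !(ipC w). Qed.

Lemma ipBr u v w : inL2 u -> inL2 v -> inL2 w -> ip w (u \- v) = ip w u - ip w v.
Proof. by move=> *; rewrite ipC ipBl// !(ipC w). Qed.

Lemma ipZr c u w : inL2 u -> inL2 w -> ip w (c \*o u) = c * ip w u.
Proof. by move=> *; rewrite ipC ipZl// (ipC w). Qed.

Lemma ip_suml n (F : nat -> R -> R) w : (forall i, inL2 (F i)) -> inL2 w ->
  ip (fun t => \sum_(i < n) F i t) w = \sum_(i < n) ip (F i) w.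
Proof.
move=> iF iw; elim: n => [|n IH].
  under eq_fun do rewrite big_ord0.
  rewrite big_ord0 /ip; under eq_Rintegral do rewrite mul0r.
  by rewrite /Rintegral integral0.
rewrite big_ord_recr /= -IH -ipDl//; last exact: inL2_sum.
by congr ip; apply/funext => t; rewrite big_ord_recr.
Qed.

Lemma ip_ge0 u : 0 <= ip u u.
Proof. by apply: Rintegral_ge0 => t _; rewrite -expr2 sqr_ge0. Qed.

Lemma ip_le u v w : inL2 u -> inL2 v -> inL2 w ->
  (forall t, I01 t -> u t * w t <= v t * w t) -> ip u w <= ip v w.
Proof.
by move=> iu iv iw uv; apply: le_Rintegral => //; exact: inL2_mul_integrable.
Qed.

Lemma ip_cauchy_schwarz u v : inL2 u -> inL2 v ->
  (ip u v) ^+ 2 <= ip u u * ip v v.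
Proof.
move=> iu iv.
have H s : 0 <= ip u u - 2 * s * ip u v + s ^+ 2 * ip v v.
  have := ip_ge0 (u \- (s \*o v)); have isv := inL2Z s iv.
  rewrite ipBr//; last exact: inL2B.
  by rewrite !ipBl// !ipZr// !ipZl// (ipC v u); lra.
have [v0|v0] := eqVneq (ip v v) 0.
  rewrite v0 mulr0; have [->|uv0] := eqVneq (ip u v) 0; first by rewrite expr0n.
  (* When [ip v v = 0] the quadratic in [s] is affine; this [s] would give it the value [-1]. *)
  have := H ((ip u u + 1) / (2 * ip u v)); rewrite v0 mulr0 addr0.
  rewrite (_ : _ - _ = -1) ?ler0N1// ; field.
  exact: uv0.
have vp : 0 < ip v v by rewrite lt_neqAle eq_sym v0 ip_ge0.
have := H (ip u v / ip v v).
rewrite (_ : _ + _ = (ip u u * ip v v - ip u v ^+ 2) / ip v v); last by field.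
by rewrite pmulr_lge0 ?invr_gt0// subr_ge0.
Qed.

Lemma ip_small u v (a b : R) : inL2 u -> inL2 v -> 0 <= a -> 0 <= b ->
  ip u u <= a ^+ 2 -> ip v v <= b ^+ 2 -> `|ip u v| <= a * b.
Proof.
move=> iu iv a0 b0 ua vb.
rewrite -(@ler_pXn2r _ 2) ?nnegrE ?mulr_ge0// real_normK ?num_real//.
rewrite exprMn; apply: le_trans (ip_cauchy_schwarz iu iv) _.
by apply: ler_pM => //; exact: ip_ge0.
Qed.

Lemma ip_eq0_ae u : inL2 u -> ip u u = 0 ->
  {ae mu, forall t, I01 t -> u t = 0}.
Proof.
move=> iu u0; have [mu_ _] := iu.
have : (\int[mu]_(t in @I01 R) `|(u t ^+ 2)%:E|)%E = 0%E.
  under eq_integral do rewrite /= ger0_norm ?sqr_ge0// expr2.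
  by rewrite ipE// u0.
move=> h; have {h} : ae_eq mu (@I01 R) (fun t => (u t ^+ 2)%:E) (cst 0%E).
  apply/ae_eq_integral_abs => //.
  by apply/measurable_EFinP; exact: measurable_funX.
apply: filterS => t /= h It; have := h It => -[] /eqP.
by rewrite sqrf_eq0 => /eqP.
Qed.

End L2.

(** * Total variation and optimality *)

Section optimality.
Variable R : realType.
Implicit Types (u v w x y z phi : R -> R) (c : R).
Local Notation mu := (@lebesgue_measure R).

Lemma continuous_inL2 u : continuous u -> inL2 u.
Proof.
move=> cu.
have [|c _ hc] := @EVT_max R (fun t => `|u t|) 0 1 ler01.
  apply: continuous_subspaceT => t.
  by apply: continuous_comp; [exact: cu|exact: norm_continuous].
apply: (@inL2_bounded _ _ `|u c|).
  by apply: measurable_funTS; exact: continuous_measurable_fun.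
move=> t; rewrite /I01 /= in_itv /= => /andP[t0 t1]; apply: hc.
by rewrite in_itv /= !ltW.
Qed.

Definition admissible phi := smooth_cpt phi /\ forall t, `|phi t| <= 1.

Lemma admissible_inL2 phi : admissible phi -> inL2 (derive1 phi).
Proof.
by move=> [[sp _] _]; exact/continuous_inL2/smooth_continuous/smooth_derive1.
Qed.

(** Real-valued form of a bound on the total variation, which keeps extended reals out of the later
    estimates. *)
Definition TV_le u c := forall phi, admissible phi -> ip u (derive1 phi) <= c.

Lemma TV_leP u c : inL2 u -> (TV u <= c%:E)%E <-> TV_le u c.
Proof.
move=> iu; split=> [uc phi aphi|uc].
  rewrite -lee_fin -ipE//; last exact: admissible_inL2.
  by apply: le_trans uc; apply: ereal_sup_ubound; exists phi.
apply: ge_ereal_sup => _ [phi aphi <-].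
by rewrite ipE ?lee_fin ?uc//; exact: admissible_inL2.
Qed.

Lemma admissible0 : admissible (fun=> 0).
Proof.
split; last by move=> t; rewrite normr0.
split; first exact: (@smooth_cst R 0).
have -> : [set t : R | 0 != 0 :> R] = set0.
  by apply/seteqP; split => t //=; rewrite eqxx.
by rewrite closure0; split; [exact: compact0|exact: sub0set].
Qed.

Lemma TV_ge0 u : (0 <= TV u)%E.
Proof.
apply: ereal_sup_ubound; exists (fun=> 0); first exact: admissible0.
rewrite (_ : derive1 _ = fun=> 0); last first.
  by apply/funext => t; rewrite derive1_cst.
by under eq_integral do rewrite mulr0; rewrite integral0.
Qed.

Lemma ip_0l w : ip (fun=> 0) w = 0.
Proof.
rewrite /ip; under eq_Rintegral do rewrite mul0r.
by rewrite /Rintegral integral0.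
Qed.

Lemma TV_le0 : TV_le (fun=> 0) 0.
Proof. by move=> phi _; rewrite ip_0l. Qed.

Lemma TV_leDZ u v (c d s : R) : inL2 u -> inL2 v -> 0 <= s ->
  TV_le u c -> TV_le v d -> TV_le (u \+ (s \*o v)) (c + s * d).
Proof.
move=> iu iv s0 uc vd phi aphi; have iphi := admissible_inL2 aphi.
have isv := inL2Z s iv.
by rewrite ipDl// ipZl// lerD ?uc// ler_wpM2l ?vd.
Qed.

(* [lam * (y - x)] is a subgradient of the total variation at [x - z]. *)
Definition optimal lam y z x := [/\ inL2 x,
  forall w c, inL2 w -> TV_le w c -> lam * ip (y \- x) w <= c &
  TV_le (x \- z) (lam * ip (y \- x) (x \- z))].

Lemma first_order_ge0 (A B : R) :
  (forall s, 0 < s -> s <= 1 -> 0 <= s * A + s ^+ 2 * B) -> 0 <= A.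
Proof.
move=> h; rewrite leNgt; apply/negP => A0.
pose s := Num.min 1 (- A / (2 * (`|B| + 1))).
have B1 : 0 < `|B| + 1 by rewrite ltr_wpDl.
have s0 : 0 < s by rewrite lt_min ltr01 divr_gt0 ?oppr_gt0// mulr_gt0.
have s1 : s <= 1 by rewrite ge_min lexx.
have sB : s * (2 * (`|B| + 1)) <= - A.
  by rewrite -ler_pdivlMr ?mulr_gt0// ge_min lexx orbT.
have := h s s0 s1; rewrite expr2 -mulrA -mulrDr pmulr_rge0// => h1.
have : s * B <= s * `|B| by rewrite ler_pM2l// ler_norm.
lra.
Qed.

(** First-order conditions along two kinds of segments: [x + s w] gives the subgradient inequality,
    and moving from [x] towards [z], where TV scales by [1 - s], gives the equality case. *)
Lemma minimizer_optimal lam y z x : 0 < lam -> inL2 y -> inL2 z ->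
  is_minimizer lam y z x -> optimal lam y z x.
Proof.
move=> lam0 iy iz [ix xmin].
have ixz := inL2B ix iz; have ixy := inL2B ix iy; have iyx := inL2B iy ix.
have upper w c : inL2 w -> TV_le (w \- z) c ->
    (tikh lam y z x <= (lam / 2 * ip (w \- y) (w \- y) + c)%:E)%E.
  move=> iw wc; apply: le_trans (xmin w iw) _.
  rewrite /tikh L2norm2E; last exact: inL2B.
  by rewrite -EFinM EFinD leeD2l//; apply/TV_leP => //; exact: inL2B.
(* The competitor [z] has zero TV term, so the minimum is finite and TV at [x - z] is a real
   number. *)
have [T TE] : exists T, TV (fun t => x t - z t) = T%:E.
  have : (tikh lam y z x < +oo)%E.
    apply: (@le_lt_trans _ _ _ _ _ _ (ltry _)); apply: (upper z 0) => //.
    rewrite (_ : z \- z = fun=> 0); first exact: TV_le0.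
    by apply/funext => t /=; rewrite subrr.
  rewrite /tikh L2norm2E// -EFinM.
  have := TV_ge0 (fun t => x t - z t).
  by case: (TV _) => //= r _ _; exists r.
have Tle : TV_le (x \- z) T by apply/TV_leP => //; rewrite -TE.
have real_min w c : inL2 w -> TV_le (w \- z) c ->
    lam / 2 * ip (x \- y) (x \- y) + T <= lam / 2 * ip (w \- y) (w \- y) + c.
  move=> iw /(upper w c iw); rewrite /tikh TE L2norm2E//.
have perturb w (s : R) : inL2 w ->
    ip ((x \+ (s \*o w)) \- y) ((x \+ (s \*o w)) \- y) =
    ip (x \- y) (x \- y) - 2 * s * ip (y \- x) w + s ^+ 2 * ip w w.
  move=> iw; have isw := inL2Z s iw.
  rewrite (_ : (x \+ (s \*o w)) \- y = (x \- y) \+ (s \*o w)); last first.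
    by apply/funext => t /=; rewrite addrAC.
  have ii := inL2D ixy isw.
  rewrite (ipDr ixy isw ii) (ipDl ixy isw ixy) (ipDl ixy isw isw).
  rewrite !(ipZr _ iw)// !(ipZl _ iw)// (ipC w (x \- y)).
  by rewrite (ipBl ix iy iw) (ipBl iy ix iw); lra.
split=> //.
  move=> w c iw wc; rewrite -subr_ge0.
  apply: (@first_order_ge0 _ (lam / 2 * ip w w)) => s s0 s1.
  have isw := inL2Z s iw.
  have := real_min (x \+ (s \*o w)) (T + s * c) (inL2D ix isw).
  rewrite perturb// (_ : (x \+ (s \*o w)) \- z = (x \- z) \+ (s \*o w)); last first.
    by apply/funext => t /=; rewrite addrAC.
  by move=> /(_ (TV_leDZ ixz iw (ltW s0) Tle wc)); lra.
suff TI : T <= lam * ip (y \- x) (x \- z) by move=> phi /Tle /le_trans; apply.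
rewrite -subr_ge0.
apply: (@first_order_ge0 _ (lam / 2 * ip (x \- z) (x \- z))) => s s0 s1.
have isw := inL2Z (- s) ixz.
have := real_min (x \+ ((- s) \*o (x \- z))) (0 + (1 - s) * T) (inL2D ix isw).
rewrite perturb// (_ : (x \+ ((- s) \*o (x \- z))) \- z =
  (fun=> 0) \+ ((1 - s) \*o (x \- z))); last first.
  by apply/funext => t /=; ring.
have s2 : 0 <= 1 - s by rewrite subr_ge0.
by move=> /(_ (TV_leDZ (@inL2_0 R) ixz s2 TV_le0 Tle)); lra.
Qed.

(** Testing each subgradient with the other's point and adding gives
    [lam * ip (x \- x') (x \- x') <= 0]. The offsets [z] and [z'] need only agree in L2, since the
    previous iterates are known to coincide only almost everywhere. *)
Lemma optimal_unique lam y z z' x x' : 0 < lam -> inL2 y -> inL2 z -> inL2 z' ->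
  ip (z \- z') (z \- z') = 0 ->
  optimal lam y z x -> optimal lam y z' x' ->
  ip (x \- x') (x \- x') = 0.
Proof.
move=> lam0 iy iz iz' zz' [ix sx tx] [ix' sx' tx'].
have izz' := inL2B iz iz'.
have z0 w : inL2 w -> ip w z = ip w z'.
  move=> iw; apply/eqP; rewrite -subr_eq0 -ipBr//.
  have := ip_cauchy_schwarz iw izz'; rewrite zz' mulr0 => h.
  by rewrite -sqrf_eq0 eq_le h sqr_ge0.
have iyx := inL2B iy ix; have iyx' := inL2B iy ix'.
have ixz := inL2B ix iz; have ixz' := inL2B ix' iz'; have ixx' := inL2B ix ix'.
have h1 := sx' _ _ ixz tx; have h2 := sx _ _ ixz' tx'.
apply/eqP; rewrite eq_le ip_ge0 andbT -(pmulr_rle0 _ lam0).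
move: h1 h2; rewrite !ipBr// ?z0//.
rewrite !ipBl// (ipC x' x); nra.
Qed.

End optimality.

(** * Step functions *)

Section cells.
Variable R : realType.
Implicit Types (u v w phi : R -> R) (c : nat -> R).
Local Notation mu := (@lebesgue_measure R).

Definition cell n i : R -> R := \1_`[i%:R / n%:R, i.+1%:R / n%:R[.

Lemma cell_inL2 n i : inL2 (cell n i).
Proof.
apply: (@inL2_bounded _ _ 1).
  apply: measurable_funTS; apply: measurable_indic; exact: measurable_itv.
by move=> t _; rewrite /cell indicE; case: (_ \in _); rewrite ?normr1 ?normr0.
Qed.

Lemma Rintegral_derive1 phi (a b : R) : smooth phi -> a < b ->
  \int[mu]_(t in `[a, b[) derive1 phi t = phi b - phi a.
Proof.
move=> sphi ab; have cphi := smooth_continuous sphi.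
have cphi' := smooth_continuous (smooth_derive1 sphi).
have wphi' : {within `[a, b], continuous (derive1 phi)}.
  exact: continuous_subspaceT.
have iphi' : mu.-integrable `[a, b] (EFin \o derive1 phi).
  apply: continuous_compact_integrable => //; exact: segment_compact.
rewrite Rintegral_itv_bndo_bndc; last first.
  apply: integrableS iphi' => //.
  by apply: subset_itvl; rewrite bnd_simp.
rewrite /Rintegral (continuous_FTC2 ab wphi' (F := phi))//.
split.
- by move=> t _; exact: (sphi 0%N).
- by apply: cvg_at_right_filter; exact: cphi.
- by apply: cvg_at_left_filter; exact: cphi.
Qed.

Lemma ip_cell n i phi : (i < n)%N -> smooth phi ->
  ip (cell n i) (derive1 phi) = phi (i.+1%:R / n%:R) - phi (i%:R / n%:R).
Proof.
move=> ltin sphi.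
have n0 : 0 < n%:R :> R by rewrite ltr0n; lia.
have iphi : inL2 (derive1 phi).
  exact/continuous_inL2/smooth_continuous/smooth_derive1.
(* Adding the null point [0] to the domain makes every cell a subset of it. *)
rewrite /ip /I01 Rintegral_itv_obnd_cbnd; last first.
  by apply: inL2_mul_integrable => //; exact: cell_inL2.
rewrite -Rintegral_derive1//; last by rewrite ltr_pM2r ?invr_gt0// ltr_nat.
set A := `[i%:R / n%:R, i.+1%:R / n%:R[%classic.
have AE : `[0, 1[%classic `&` A = A.
  apply/setIidPr => t; rewrite /A /= !in_itv /= => /andP[t1 t2].
  rewrite (le_trans _ t1) ?divr_ge0//=.
  by rewrite (lt_le_trans t2)// ler_pdivrMr// mul1r ler_nat.
rewrite -AE Rintegral_mkcondr; apply: eq_Rintegral => t _.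
rewrite /cell indicE patchE -/A; by case: (t \in A); rewrite ?mul1r ?mul0r.
Qed.

Lemma smooth_id : smooth (@id R).
Proof.
by apply: (@is_derive_smooth _ _ (fun=> 1)); exact: smooth_cst.
Qed.

Lemma ip_cell_cell n i : (i < n)%N -> ip (cell n i) (cell n i) = n%:R^-1.
Proof.
(* An indicator equals its square, so the integral is the increment of the identity over the
   cell. *)
move=> ltin; transitivity (ip (cell n i) (derive1 id)).
  apply: eq_Rintegral => t _; rewrite derive1_id mulr1 /cell indicE.
  by case: (_ \in _); rewrite ?mulr1 ?mulr0.
rewrite ip_cell//; last exact: smooth_id.
by rewrite -mulrBl -natr1 addrAC subrr add0r mul1r.
Qed.

(** [cell 1 0] serves as the constant [1] on the unit interval. *)
Lemma ip_derive1 phi : smooth phi -> 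
  ip (cell 1 0) (derive1 phi) = phi 1 - phi 0.
Proof. by move=> sphi; rewrite ip_cell// divr1 mul0r. Qed.

Definition step n c : R -> R := fun t => \sum_(i < n) (c i \*o cell n i) t.

Lemma step_inL2 n c : inL2 (step n c).
Proof.
apply: (@inL2_sum _ n (fun i => c i \*o cell n i)) => i.
exact/inL2Z/cell_inL2.
Qed.

Lemma stepB n c c' : step n c \- step n c' = step n (fun i => c i - c' i).
Proof.
apply/funext => t; rewrite /step /= -sumrB; apply: eq_bigr => i _ /=.
by rewrite mulrBl.
Qed.

Lemma ip_step n c phi : smooth phi -> ip (step n c) (derive1 phi) =
  \sum_(i < n) c i * (phi (i.+1%:R / n%:R) - phi (i%:R / n%:R)).
Proof.
move=> sphi.
have iphi : inL2 (derive1 phi).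
  exact/continuous_inL2/smooth_continuous/smooth_derive1.
rewrite (@ip_suml _ n (fun i => c i \*o cell n i))//; last first.
  by move=> i; exact/inL2Z/cell_inL2.
by apply: eq_bigr => i _; rewrite ipZl ?ip_cell//; exact: cell_inL2.
Qed.

Lemma smooth_cpt_end phi : smooth_cpt phi -> phi 0 = 0 /\ phi 1 = 0.
Proof.
move=> [_ [_ sub]]; split; apply/eqP; apply/negP => /negP;
  move=> /(@subset_closure _ [set t | phi t != 0]) /sub.
  by rewrite /I01 /= in_itv /= ltxx.
by rewrite /I01 /= in_itv /= ltxx andbF.
Qed.

Lemma sum_mul_increment c (b : nat -> R) m :
  \sum_(i < m.+1) c i * (b i.+1 - b i) =
  c m * b m.+1 - c 0%N * b 0%N - \sum_(i < m) b i.+1 * (c i.+1 - c i).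
Proof.
elim: m => [|m IH]; first by rewrite big_ord_recl !big_ord0 /=; ring.
by rewrite big_ord_recr /= IH [X in _ = _ - X]big_ord_recr /=; ring.
Qed.

(** Discrete integration by parts: [phi] vanishes at both ends, so only its values at the [m]
    interior nodes matter. Prescribing nodal values therefore determines the pairing. *)
Lemma ip_step_parts m c phi : smooth_cpt phi ->
  ip (step m.+1 c) (derive1 phi) =
  - \sum_(i < m) phi (i.+1%:R / m.+1%:R) * (c i.+1 - c i).
Proof.
move=> cphi; have [p0 p1] := smooth_cpt_end cphi; case: cphi => sphi _.
rewrite ip_step// (@sum_mul_increment c (fun i => phi (i%:R / m.+1%:R))).
by rewrite divff ?pnatr_eq0// mul0r p0 p1 !mulr0 subrr sub0r.
Qed.

Lemma TV_step_le m c : TV_le (step m.+1 c) (\sum_(i < m) `|c i.+1 - c i|).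
Proof.
move=> phi [cphi phi1]; rewrite ip_step_parts// -sumrN; apply: ler_sum => i _.
rewrite -mulNr; apply: le_trans (ler_norm _) _.
by rewrite normrM normrN ler_piMl.
Qed.

Lemma ip_add_le u v (a b : R) : inL2 u -> inL2 v -> 0 <= a -> 0 <= b ->
  ip u u <= a ^+ 2 -> ip v v <= b ^+ 2 -> ip (u \+ v) (u \+ v) <= (a + b) ^+ 2.
Proof.
move=> iu iv a0 b0 ua vb; have iuv := inL2D iu iv.
rewrite (ipDr iu iv iuv) (ipDl iu iv iu) (ipDl iu iv iv) (ipC v u).
have := ip_small iu iv a0 b0 ua vb; have := ler_norm (ip u v).
nra.
Qed.

Lemma ip_sub_le u v (a b : R) : inL2 u -> inL2 v -> 0 <= a -> 0 <= b ->
  ip u u <= a ^+ 2 -> ip v v <= b ^+ 2 -> ip (u \- v) (u \- v) <= (a + b) ^+ 2.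
Proof.
move=> iu iv a0 b0 ua vb; have iuv := inL2B iu iv.
rewrite (ipBr iu iv iuv) (ipBl iu iv iu) (ipBl iu iv iv) (ipC v u).
have := ip_small iu iv a0 b0 ua vb; have := ler_norm (- ip u v).
rewrite normrN; nra.
Qed.

Lemma ip_sum_le n (F : nat -> R -> R) (a : R) : 0 <= a -> (forall i, inL2 (F i)) ->
  (forall i, (i < n)%N -> ip (F i) (F i) <= a ^+ 2) ->
  ip (fun t => \sum_(i < n) F i t) (fun t => \sum_(i < n) F i t) <= (n%:R * a) ^+ 2.
Proof.
move=> a0 iF; elim: n => [|n IH] h.
  under eq_fun do rewrite big_ord0.
  by rewrite ip_0l mul0r expr0n.
rewrite (_ : (fun t => _) = (fun t => \sum_(i < n) F i t) \+ F n); last first.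
  by apply/funext => t; rewrite big_ord_recr.
rewrite -natr1 mulrDl mul1r; apply: ip_add_le => //.
- exact: inL2_sum.
- exact: mulr_ge0.
- by apply: IH => i ilt; apply: h; exact: ltnW.
- exact: h.
Qed.

(** Write [s] for the rescaled slope. Its integral over the cell and the squared norm of the cell
    are both [1/n], while [0 <= s <= 1 + e] bounds its own squared norm by [(1 + e)/n]; expanding
    the square leaves [e/n]. *)
Lemma scaled_step_close S (d e : R) n i : 0 < d -> smooth S ->
  (forall t, t <= d -> S t = 0) -> (forall t, 1 - d <= t -> S t = 1) ->
  (forall t, 0 <= derive1 S t <= 1 + e) -> (i < n)%N ->
  let u := (fun t => derive1 S (n%:R * t - i%:R)) \- cell n i in
  ip u u <= e / n%:R.
Proof.
move=> d0 sS S0 S1 S' ltin /=.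
have n0 : 0 < n%:R :> R by rewrite ltr0n; lia.
pose sg := fun t : R => n%:R^-1 * S (n%:R * t - i%:R).
have dsg : forall t : R, is_derive t 1 sg (derive1 S (n%:R * t - i%:R)).
  move=> t; have := is_derive_affine (smooth_is_derive sS (n%:R * t - i%:R)).
  move=> /(is_deriveZ n%:R^-1); rewrite /GRing.scale /= mulKf ?gt_eqF//.
have ssg : smooth sg.
  by apply: smoothM; [exact: smooth_cst|exact: smooth_affine].
set s := fun t : R => _; have sE : derive1 sg = s by exact: derive1_fun.
have is_ : inL2 s.
  by rewrite -sE; exact/continuous_inL2/smooth_continuous/smooth_derive1.
have ic := cell_inL2 n i; have isc := inL2B is_ ic.
rewrite (ipBr is_ ic isc) (ipBl is_ ic is_) (ipBl is_ ic ic) (ipC s).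
have nS k : sg (k%:R / n%:R) = n%:R^-1 * S (k%:R - i%:R).
  by rewrite /sg mulrCA divff ?gt_eqF// mulr1.
have S00 t : t <= 0 -> S t = 0.
  by move=> t0; apply: S0; rewrite (le_trans t0)// ltW.
have S11 t : 1 <= t -> S t = 1.
  by move=> t1; apply: S1; rewrite (le_trans _ t1)// gerBl ltW.
have -> : ip (cell n i) s = n%:R^-1.
  rewrite -sE ip_cell// !nS subrr (S00 0)// mulr0 subr0.
  by rewrite -natr1 addrAC subrr add0r S11// mulr1.
rewrite ip_cell_cell//.
suff : ip s s <= (1 + e) * n%:R^-1 by lra.
have -> : (1 + e) * n%:R^-1 = ip ((1 + e) \*o cell 1 0) s.
  rewrite ipZl//; last exact: cell_inL2.
  rewrite -sE ip_derive1// /sg mulr1 mulr0 sub0r.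
  rewrite S11; last by rewrite -natrB ?(ltnW ltin)// ler1n subn_gt0.
  by rewrite S00 ?oppr_le0// mulr0 subr0 mulr1.
apply: ip_le => //; first exact/inL2Z/cell_inL2.
move=> t; rewrite /I01 /= in_itv /= => /andP[t0 t1].
have /andP[st0 st1] := S' (n%:R * t - i%:R).
rewrite ler_wpM2r// /cell indicE mem_set ?mulr1//=.
by rewrite in_itv /= mul0r divr1 (ltW t0).
Qed.

Lemma smooth_interpolant n (F : nat -> R) (r : R) : (0 < n)%N -> 0 < r ->
  F 0%N = 0 -> F n = 0 -> (forall i, `|F i| <= 1) ->
  exists phi, [/\ admissible phi,
    forall i, (i <= n)%N -> phi (i%:R / n%:R) = F i &
    let u := derive1 phi \- step n (fun i => n%:R * (F i.+1 - F i)) in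
    ip u u <= r ^+ 2].
Proof.
move=> n0 r0 F0 Fn F1.
have nR : 0 < n%:R :> R by rewrite ltr0n.
(* Each of the [n] summands has squared norm at most [n^2 * 2^2 * (e/n) = (r/n)^2], where [2] bounds
   the increments of [F]. *)
pose e := (r / n%:R) ^+ 2 / (4 * n%:R).
have e0 : 0 < e by apply: divr_gt0; [rewrite exprn_gt0// divr_gt0|rewrite mulr_gt0].
have [S [d [d0 sS S0 S1 S']]] := smooth_step e0.
have S'0 t : 0 <= derive1 S t by case/andP: (S' t).
exists (smooth_interp S F n); split.
- split; first exact: (smooth_interp_cpt d0).
  by move=> t; exact: (smooth_interp_le1 _ sS S0 S1).
- by move=> i; exact: (smooth_interp_node d0).
pose u i := (fun t => derive1 S (n%:R * t - i%:R)) \- cell n i.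
pose G i := (n%:R * (F i.+1 - F i)) \*o u i.
rewrite /= (_ : _ \- _ = fun t => \sum_(i < n) G i t); last first.
  apply/funext => t; rewrite /= derive1_smooth_interp// /step -sumrB.
  by apply: eq_bigr => i _; rewrite /G /u /=; ring.
have iu i : inL2 (u i).
  apply: inL2B; last exact: cell_inL2.
  apply: continuous_inL2; apply: smooth_continuous.
  exact/smooth_affine/smooth_derive1.
rewrite -[r](@divfK _ n%:R) ?gt_eqF// [X in _ <= X ^+ 2]mulrC.
apply: ip_sum_le => [|i|i ilt]; first by rewrite ltW// divr_gt0.
  exact: inL2Z.
rewrite ipZl// ?ipZr//; last exact: inL2Z.
have uu := scaled_step_close d0 sS S0 S1 S' ilt.
have FF : (F i.+1 - F i) ^+ 2 <= 2 ^+ 2.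
  rewrite -[X in X <= _]real_normK ?num_real// lerXn2r ?nnegrE//.
  by rewrite (le_trans (ler_normB _ _))// (_ : 2 = 1 + 1)// lerD.
rewrite mulrA -expr2 exprMn.
apply: (@le_trans _ _ (n%:R ^+ 2 * 2 ^+ 2 * (e / n%:R))).
  apply: ler_pM => //; first by rewrite mulr_ge0 ?sqr_ge0.
    exact: ip_ge0.
  by rewrite ler_wpM2l// sqr_ge0.
rewrite /e le_eqVlt; apply/orP; left; apply/eqP; field.
by rewrite gt_eqF.
Qed.

End cells.

(** * Density of step functions *)

Section density.
Variable R : realType.
Implicit Types (u v w y g h : R -> R) (c : nat -> R).
Local Notation mu := (@lebesgue_measure R).

Lemma L2_dominated (f : nat -> R -> R) h : inL2 h ->
  (forall n, measurable_fun (@I01 R) (f n)) ->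
  (forall n t, I01 t -> `|f n t| <= h t) ->
  (forall t, I01 t -> f ^~ t @ \oo --> (0 : R)) ->
  forall e, 0 < e -> \forall n \near \oo, ip (f n) (f n) <= e.
Proof.
move=> ih mf fh f0 e e0.
have ifn n : inL2 (f n).
  apply: inL2_le ih _ => // t It; apply: le_trans (fh n t It) _.
  exact: ler_norm.
have H : (\int[mu]_(t in @I01 R) (f n t ^+ 2)%:E)%E @[n --> \oo] --> 0%E.
  rewrite -(@integral0 _ _ _ mu (@I01 R)).
  apply: (@dominated_cvg _ _ _ mu _ _ _ (fun=> 0%E) (fun t => (h t ^+ 2)%:E)) => //.
  - exact: measurable_itv.
  - by move=> n; apply/measurable_EFinP; apply: measurable_funX; exact: mf.
  - move=> t It; apply: cvg_EFin; first exact: nearW.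
    rewrite (_ : 0 = 0 ^+ 2 :> R); last by rewrite expr0n.
    apply: (@cvg_comp _ _ _ _ (fun x : R => x ^+ 2) _ _ _ (f0 t It)).
    exact: exprn_continuous.
  - by case/inL2P : ih.
  - move=> n t It /=; rewrite lee_fin normrX lerXn2r ?nnegrE ?fh//.
    exact: le_trans (fh n t It).
have : ip (f n) (f n) @[n --> \oo] --> (0 : R).
  have -> : (fun n => ip (f n) (f n)) =
      (fine \o fun n => (\int[mu]_(t in @I01 R) (f n t ^+ 2)%:E)%E).
    apply/funext => n /=.
    by rewrite (_ : (\int[mu]_(t in _) _)%E = L2norm2 (f n))// L2norm2E.
  by apply: fine_cvg; exact: H.
move=> /cvgr0Pnorm_le /(_ e e0); apply: filterS => n /=.
by apply: le_trans; exact: ler_norm.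
Qed.

Definition clamp (K x : R) := Num.max (- K) (Num.min K x).

Lemma clampP K x : 0 <= K -> [\/ x <= - K /\ clamp K x = - K,
  - K <= x <= K /\ clamp K x = x | K <= x /\ clamp K x = K].
Proof.
move=> K0; rewrite /clamp; have [xK|Kx] := leP x K; last first.
  by constructor 3; rewrite ltW// max_r//; lra.
have [xK'|Kx] := leP x (- K); first by constructor 1.
by constructor 2; rewrite (ltW Kx).
Qed.

Lemma clamp_norm K x : 0 <= K -> `|clamp K x| <= K.
Proof.
move=> K0; rewrite ler_norml.
by case: (clampP x K0) => -[h ->] //; rewrite lexx; lra.
Qed.

Lemma clamp_id K x : `|x| <= K -> clamp K x = x.
Proof.
move=> xK; have K0 := le_trans (normr_ge0 x) xK.
by move: xK; rewrite ler_norml => /andP[? ?]; case: (clampP x K0) => -[? ->]; lra.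
Qed.

Lemma clamp_lip K x x' : 0 <= K -> `|clamp K x - clamp K x'| <= `|x - x'|.
Proof.
move=> K0; wlog xx : x x' / x' <= x.
  move=> H; have [|/ltW] := leP x' x; first exact: H.
  by move=> /H; rewrite distrC [X in _ -> _ <= X]distrC.
rewrite [leRHS]ger0_norm ?subr_ge0// ler_norml.
case: (clampP x K0) => -[? ->]; case: (clampP x' K0) => -[? ->];
  by apply/andP; split; lra.
Qed.

Lemma clamp_dist K x : 0 <= K -> `|x - clamp K x| <= `|x|.
Proof.
move=> K0; case: (clampP x K0) => -[h ->].
- by rewrite !ler0_norm; lra.
- by rewrite subrr normr0.
- by rewrite !ger0_norm; lra.
Qed.

Lemma continuous_clamp K g : continuous g -> continuous (fun t => clamp K (g t)).
Proof.
move=> cg t.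
have cmin : {for t, continuous (cst K \min (g : R -> R^o))}.
  by apply: continuous_min; [exact: cst_continuous|exact: cg].
apply: (@continuous_max _ _ (cst (- K)) (cst K \min g) t _ cmin).
exact: cst_continuous.
Qed.

Lemma measurable_clamp K u : measurable_fun (@I01 R) u ->
  measurable_fun (@I01 R) (fun t => clamp K (u t)).
Proof.
move=> mu_; apply: measurable_maxr; first exact: measurable_cst.
by apply: measurable_minr => //; exact: measurable_cst.
Qed.

Lemma truncation_dense y (r : R) : inL2 y -> 0 < r -> exists K : R, 0 <= K /\
  let u := y \- (fun t => clamp K (y t)) in ip u u <= r.
Proof.
move=> iy r0; have [my _] := iy.
pose f (k : nat) := y \- (fun t => clamp k%:R (y t)).
have iay : inL2 (fun t => `|y t|).
  apply: inL2_le iy _; last by move=> t _; rewrite normr_id.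
  exact: measurableT_comp.
have mf k : measurable_fun (@I01 R) (f k).
  by apply: measurable_funB => //; exact: measurable_clamp.
have fy k t : I01 t -> `|f k t| <= `|y t| by move=> _; exact: clamp_dist.
have [|N _ /(_ N (leqnn N)) h] := L2_dominated iay mf fy _ r0; last first.
  by exists N%:R; split.
move=> t _; apply: cvg_near_cst; exists (Num.truncn `|y t|).+1 => // k /= hk.
rewrite /f /= clamp_id ?subrr//; apply: ltW.
have /andP[_ h] := truncn_itv (normr_ge0 (y t)).
by apply: lt_le_trans h _; rewrite ler_nat.
Qed.

(** For functions bounded by [K] the squared L2 distance is at most [2 * K] times the L1 distance,
    so L1 density suffices. Clamping the approximant keeps it continuous and, being 1-Lipschitz and
    fixing [y], does not increase the distance. *)
Lemma continuous_dense_bounded y (K r : R) : measurable_fun (@I01 R) y -> 0 <= K ->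
  (forall t, `|y t| <= K) -> 0 < r ->
  exists2 g, continuous g & ip (y \- g) (y \- g) <= r.
Proof.
move=> my K0 yK r0.
have iy : inL2 y by apply: (@inL2_bounded _ _ K).
have i1 : inL2 (fun=> 1 : R) by apply: (@inL2_bounded _ _ 1) => // t _; rewrite normr1.
have int_y : mu.-integrable (@I01 R) (EFin \o y).
  have := inL2_mul_integrable iy i1.
  by under eq_fun do rewrite mulr1.
have [||g_ [cg ig]] := @approximation_continuous_integrable R (@I01 R) y _ _ int_y.
- exact: measurable_itv.
- by rewrite /= lebesgue_I01 ltry.
(* The added [1] keeps the denominator positive when [K = 0]. *)
pose e := r / (2 * K + 1).
have K1 : 0 < 2 * K + 1 by lra.
have e0 : 0 < e by rewrite divr_gt0.
move=> /fine_cvgP[[m _ fgfin]] /cvgrPdist_le /(_ e e0)[p _] /(_ _ (leq_addr m p)).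
have /= := fgfin _ (leq_addl p m).
set g := g_ (p + m)%N => gfin; rewrite /= sub0r normrN => he.
exists (fun t => clamp K (g t)); first exact/continuous_clamp/cg.
set gK := fun t => _.
have igK : inL2 gK by exact/continuous_inL2/continuous_clamp/cg.
have iygK := inL2B iy igK.
have int_yg : mu.-integrable (@I01 R) (EFin \o (fun t => `|y t - g t|)).
  have iyg : mu.-integrable (@I01 R) (fun t => (y t)%:E - (g t)%:E)%E.
    apply: integrableB => //; [exact: measurable_itv|exact: ig].
  exact: (integrable_abse iyg).
have : ip (y \- gK) (y \- gK) <= \int[mu]_(t in @I01 R) ((2 * K) * `|y t - g t|).
  apply: le_Rintegral.
  - exact: measurable_itv.
  - exact: inL2_mul_integrable.
  - suff : mu.-integrable (@I01 R) (fun t => (2 * K)%:E * `|y t - g t|%:E)%E by [].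
    by apply: integrableZl => //; exact: measurable_itv.
  move=> t _ /=; rewrite -expr2 -real_normK ?num_real// expr2.
  have yE : y t = clamp K (y t) by rewrite clamp_id.
  apply: ler_pM => //.
    apply: le_trans (ler_normB _ _) _; have := clamp_norm (g t) K0; have := yK t.
    rewrite /gK; lra.
  by rewrite {1}yE; exact: clamp_lip.
rewrite RintegralZl//; last exact: measurable_itv.
move=> h; apply: le_trans h _.
have : \int[mu]_(t in @I01 R) `|y t - g t| <= e.
  by apply: le_trans he; exact: ler_norm.
move=> h; apply: (@le_trans _ _ (2 * K * e)); first by rewrite ler_wpM2l// mulr_ge0.
rewrite /e mulrA ler_pdivrMr//; nra.
Qed.

Lemma step_at n c i (t : R) : (i < n)%N -> i%:R / n%:R <= t < i.+1%:R / n%:R ->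
  step n c t = c i.
Proof.
move=> ltin hit; have n0 : 0 < n%:R :> R by rewrite ltr0n; lia.
rewrite /step (bigD1 (Ordinal ltin))//= big1 ?addr0; last first.
  move=> j; rewrite -(inj_eq val_inj) /= => ji.
  rewrite /cell indicE memNset ?mulr0//= in_itv /= => hjt.
  have /andP[h1 h2] := hit; have /andP[h3 h4] := hjt.
  have := le_lt_trans h1 h4; have := le_lt_trans h3 h2.
  by rewrite !ltr_pM2r ?invr_gt0// !ltr_nat; lia.
by rewrite /cell indicE mem_set ?mulr1//= in_itv.
Qed.

(** Sampling at left endpoints converges pointwise by continuity, and twice the maximum of [|g|] on
    [[0, 1]] dominates the error. *)
Lemma step_dense_continuous g (r : R) : continuous g -> 0 < r ->
  exists n c, (0 < n)%N /\ ip (g \- step n c) (g \- step n c) <= r.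
Proof.
move=> cg r0.
pose f n := g \- step n.+1 (fun i => g (i%:R / n.+1%:R)).
have [|C _ hC] := @EVT_max R (fun t => `|g t|) 0 1 ler01.
  apply: continuous_subspaceT => t.
  by apply: continuous_comp; [exact: cg|exact: norm_continuous].
have node n (t : R) : I01 t ->
    exists2 i, (i < n.+1)%N & i%:R / n.+1%:R <= t < i.+1%:R / n.+1%:R.
  rewrite /I01 /= in_itv /= => /andP[t0 t1].
  have n0 : 0 < n.+1%:R :> R by rewrite ltr0n.
  have nt0 : 0 <= n.+1%:R * t by rewrite mulr_ge0// ltW.
  have /andP[h1 h2] := truncn_itv nt0.
  exists (Num.truncn (n.+1%:R * t)).
    by rewrite -(ltr_nat R) (le_lt_trans h1)// gtr_pMr.
  by rewrite ler_pdivrMr// ltr_pdivlMr// (mulrC t) h1.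
have ih : inL2 (fun=> 2 * `|g C|).
  by apply: (@inL2_bounded _ _ `|2 * `|g C| |).
have mf n : measurable_fun (@I01 R) (f n).
  have := step_inL2 n.+1 (fun i => g (i%:R / n.+1%:R)).
  by move=> /(inL2B (continuous_inL2 cg)) [].
have fh n t : I01 t -> `|f n t| <= 2 * `|g C|.
  move=> It; have [i iltn hit] := node n t It.
  rewrite /f /= (step_at _ iltn hit) (le_trans (ler_normB _ _))//.
  rewrite mulr2n mulrDl mul1r lerD// hC// in_itv /=.
    by move: It; rewrite /I01 /= in_itv /= => /andP[]; lra.
  by rewrite divr_ge0//= ler_pdivrMr ?ltr0n// mul1r ler_nat ltnW.
have [|N _ /(_ N (leqnn N)) h] := L2_dominated ih mf fh _ r0; last first.
  by exists N.+1, (fun i => g (i%:R / N.+1%:R)).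
move=> t It; apply/cvgr0Pnorm_le => e e0.
have /cvgrPdist_le /(_ e e0) /nbhs_ballP[d /= d0 hd] := cg t.
exists (Num.truncn d^-1) => // n /= hn.
have [i iltn hit] := node n t It.
rewrite /f /= (step_at _ iltn hit); apply: hd; rewrite /ball /=.
have /andP[h1 h2] := hit.
have n0 : 0 < n.+1%:R :> R by rewrite ltr0n.
rewrite ger0_norm ?subr_ge0//.
apply: (@lt_le_trans _ _ n.+1%:R^-1).
  by move: h2; rewrite ltrBlDl -natr1 mulrDl mul1r.
rewrite -[leRHS]invrK lef_pV2 ?posrE ?invr_gt0//.
have /andP[_ h3] : (Num.truncn d^-1)%:R <= d^-1 < (Num.truncn d^-1).+1%:R.
  by apply: truncn_itv; rewrite invr_ge0 ltW.
by rewrite ltW// (lt_le_trans h3)// ler_nat.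
Qed.

Lemma step_dense y (r : R) : inL2 y -> 0 < r ->
  exists n c, (0 < n)%N /\ ip (y \- step n c) (y \- step n c) <= r ^+ 2.
Proof.
move=> iy r0; pose e := r / 3; have e0 : 0 < e by rewrite divr_gt0.
have e20 : 0 < e ^+ 2 by rewrite exprn_gt0.
have [K [K0 hK]] := truncation_dense iy e20.
have [my _] := iy; have mK := measurable_clamp K my.
have [g cg hg] := continuous_dense_bounded mK K0 (fun t => clamp_norm (y t) K0) e20.
have [n [c [n0 hc]]] := step_dense_continuous cg e20.
exists n, c; split=> //.
have ig := continuous_inL2 cg; have is_ := step_inL2 n c.
have iK : inL2 (fun t => clamp K (y t)).
  by apply: (@inL2_bounded _ _ K) => // t _; exact: clamp_norm.
rewrite (_ : y \- step n c = ((y \- (fun t => clamp K (y t))) \+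
  ((fun t => clamp K (y t)) \- g)) \+ (g \- step n c)); last first.
  by apply/funext => t /=; ring.
rewrite (_ : r = e + e + e); last by rewrite /e; field.
have i1 := inL2B iy iK; have i2 := inL2B iK ig; have i3 := inL2B ig is_.
apply: ip_add_le => //; rewrite ?addr_ge0 ?(ltW e0)//; first exact: inL2D.
by apply: ip_add_le => //; rewrite (ltW e0).
Qed.

End density.

(** * Nestedness of the minimizers *)

Section nested.
Variable R : realType.
Implicit Types (u v w x y z phi : R -> R) (c F : nat -> R).

(** The interpolant has slope close to [m.+1] times the increment of [F], hence the discrete
    parameter [m.+1 * a] for the continuous [a]. By [taut_norm] it attains the total variation of
    the residual step function. *)
Lemma TV_step_taut m (a r : R) c F : 0 < a -> 0 < r ->
  taut m.+1 (m.+1%:R * a) c F ->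
  exists phi, [/\ admissible phi,
    forall i, (i <= m.+1)%N -> phi (i%:R / m.+1%:R) = F i,
    TV_le (step m.+1 (dres (m.+1%:R * a) c F))
      (ip (step m.+1 (dres (m.+1%:R * a) c F)) (derive1 phi)) &
    let u := step m.+1 c \-
      (step m.+1 (dres (m.+1%:R * a) c F) \+ (a \*o derive1 phi)) in
    ip u u <= r ^+ 2].
Proof.
move=> a0 r0 tF; have [F0 Fn F1 _] := tF.
(* The final error is [a] times the interpolation error. *)
have ra0 : 0 < r / a by rewrite divr_gt0.
have [phi [aphi phiF hphi]] := smooth_interpolant (ltn0Sn m) ra0 F0 Fn F1.
exists phi; split; [exact: aphi|exact: phiF| |].
  rewrite ip_step_parts; last by case: aphi.
  rewrite (_ : - _ = \sum_(i < m)
    `|dres (m.+1%:R * a) c F i.+1 - dres (m.+1%:R * a) c F i|).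
    exact: TV_step_le.
  rewrite -sumrN; apply: eq_bigr => i _; rewrite phiF; last by rewrite ltnW// ltnS.
  by rewrite (taut_norm tF)// ltnS.
have iphi := admissible_inL2 aphi.
set w := derive1 phi \- _ in hphi.
have iw : inL2 w by apply: inL2B => //; exact: step_inL2.
rewrite (_ : step m.+1 c \- _ = (- a) \*o w); last first.
  apply/funext => t; rewrite /w /= opprD addrA.
  have := congr1 (fun f => f t) (stepB m.+1 c (dres (m.+1%:R * a) c F)) => /= ->.
  rewrite mulrBr mulNr [RHS]addrC -mulNr opprK; congr (_ - _).
  by rewrite /step mulr_sumr; apply: eq_bigr => i _ /=; rewrite /dres; ring.
rewrite /= ipZl// ?ipZr//; last exact: inL2Z.
move: hphi; rewrite /= expr_div_n ler_pdivlMr ?exprn_gt0//; nra.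
Qed.

(** Both dual problems use the same step approximation of [y], so [taut_diff_norm] applies and a
    single [phi2] attains the total variation of both [x2] and [x2 - x1]. *)
Lemma nested_approximation (a1 a2 r : R) y : inL2 y -> 0 < a2 -> a2 <= a1 -> 0 < r ->
  exists x1 x2 phi1 phi2,
  [/\ [/\ inL2 x1, inL2 x2, admissible phi1 & admissible phi2],
    [/\ TV_le x1 (ip x1 (derive1 phi1)), TV_le x2 (ip x2 (derive1 phi2)) &
      TV_le (x2 \- x1) (ip (x2 \- x1) (derive1 phi2))],
    ip (y \- (x1 \+ (a1 \*o derive1 phi1)))
      (y \- (x1 \+ (a1 \*o derive1 phi1))) <= r ^+ 2 &
    ip (y \- (x2 \+ (a2 \*o derive1 phi2)))
      (y \- (x2 \+ (a2 \*o derive1 phi2))) <= r ^+ 2].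
Proof.
move=> iy a20 a12 r0; have a10 := lt_le_trans a20 a12.
have r20 : 0 < r / 2 by rewrite divr_gt0.
have [n [c [n0 yc]]] := step_dense iy r20.
case: n n0 yc => // m _ yc.
have m0 : 0 < m.+1%:R :> R by rewrite ltr0n.
have [F1 t1] := @taut_exists R m.+1 (m.+1%:R * a1) c (mulr_gt0 m0 a10).
have [F2 t2] := @taut_exists R m.+1 (m.+1%:R * a2) c (mulr_gt0 m0 a20).
have [phi1 [ad1 _ TV1 c1]] := TV_step_taut a10 r20 t1.
have [phi2 [ad2 phiF2 TV2 c2]] := TV_step_taut a20 r20 t2.
have close phi x a : admissible phi -> inL2 x ->
    ip (step m.+1 c \- (x \+ (a \*o derive1 phi)))
      (step m.+1 c \- (x \+ (a \*o derive1 phi))) <= (r / 2) ^+ 2 ->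
    ip (y \- (x \+ (a \*o derive1 phi))) (y \- (x \+ (a \*o derive1 phi))) <= r ^+ 2.
  move=> /admissible_inL2 iphi ix h.
  rewrite (_ : y \- _ = (y \- step m.+1 c) \+ (step m.+1 c \- (x \+ (a \*o derive1 phi)))).
    have is_ := step_inL2 m.+1 c.
    rewrite [X in _ <= X ^+ 2](splitr r); apply: ip_add_le => //; try exact: ltW.
      exact: inL2B.
    by apply: inL2B => //; apply: inL2D => //; exact: inL2Z.
  by apply/funext => t /=; rewrite addrA subrK.
exists (step m.+1 (dres (m.+1%:R * a1) c F1)),
  (step m.+1 (dres (m.+1%:R * a2) c F2)), phi1, phi2.
have i1 := step_inL2 m.+1 (dres (m.+1%:R * a1) c F1).
have i2 := step_inL2 m.+1 (dres (m.+1%:R * a2) c F2).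
split; [by split| |exact: (close _ _ _ ad1 i1 c1)|exact: (close _ _ _ ad2 i2 c2)].
split; [exact: TV1|exact: TV2|]; rewrite stepB ip_step_parts; last by case: ad2.
set d := fun i => _.
rewrite (_ : - _ = \sum_(i < m) `|d i.+1 - d i|); first exact: TV_step_le.
rewrite -sumrN; apply: eq_bigr => i _; rewrite phiF2; last by rewrite ltnW// ltnS.
apply/esym; apply: (taut_diff_norm _ _ t1 t2); last by rewrite ltnS.
  exact: mulr_gt0.
by rewrite ler_wpM2l// ltW.
Qed.

(** [x'] is exactly optimal for the perturbed datum [x' + lam^-1 phi']. Monotonicity of subgradients
    and the Cauchy-Schwarz inequality then make the map from data to minimizers nonexpansive. *)
Lemma optimal_stable (lam : R) y x x' phi r : 0 < lam -> inL2 y -> inL2 x' -> 0 <= r ->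
  optimal lam y (fun=> 0) x -> admissible phi -> TV_le x' (ip x' (derive1 phi)) ->
  ip (y \- (x' \+ (lam^-1 \*o derive1 phi)))
    (y \- (x' \+ (lam^-1 \*o derive1 phi))) <= r ^+ 2 ->
  ip (x \- x') (x \- x') <= r ^+ 2.
Proof.
move=> lam0 iy ix' r0 [ix sx tx] aphi tx' hr.
have iphi := admissible_inL2 aphi.
have izx : x \- (fun=> 0) = x by apply/funext => t /=; rewrite subr0.
rewrite izx in tx.
have iZ := inL2Z lam^-1 iphi; have iD := inL2D ix' iZ.
have h1 := sx _ _ ix' tx'; have h2 := tx _ aphi.
set d := y \- _ in hr; have id_ : inL2 d by exact: inL2B.
have ixx := inL2B ix ix'.
have key : ip (x \- x') (x \- x') <= ip d (x \- x').
  rewrite /d (ipBl iy iD ixx) (ipDl ix' iZ ixx) (ipZl _ iphi ixx).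
  rewrite (ipBl ix ix' ixx) !(ipBr ix ix')//.
  move: h1 h2; rewrite (ipBl iy ix ix') (ipBl iy ix ix) !(ipC _ (derive1 phi)).
  set A := ip (derive1 phi) x; set B := ip (derive1 phi) x' => h1 h2.
  have : lam * (lam^-1 * (A - B)) = A - B.
    by rewrite mulrA divff ?mul1r// gt_eqF.
  by rewrite -(ler_pM2l lam0) (ipC x' x); move: (lam^-1 * _) => q; lra.
set D := ip (x \- x') (x \- x') in key *.
have D0 : 0 <= D by exact: ip_ge0.
have := ip_cauchy_schwarz id_ ixx; rewrite -/D => cs.
have [->|Dn0] := eqVneq D 0; first exact: sqr_ge0.
apply: le_trans hr; have Dp : 0 < D by rewrite lt_neqAle eq_sym Dn0.
rewrite -(ler_pM2r Dp); apply: le_trans cs.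
by rewrite -expr2 lerXn2r ?nnegrE// (le_trans D0).
Qed.

Lemma le_of_linear_error (A B C : R) :
  (forall r, 0 < r -> r <= 1 -> A <= B + C * r) -> A <= B.
Proof.
move=> h; rewrite -subr_ge0; apply: (@first_order_ge0 _ _ C) => s s0 s1.
have := h s s0 s1; nra.
Qed.

(** The four errors come from replacing two factors of a pairing by approximations; the one
    quadratic in [r] is absorbed using [r <= 1]. *)
Lemma error_budget (A B e1 e2 e3 e4 n1 n2 n3 l r : R) : 0 <= l -> 0 <= r -> r <= 1 ->
  A - e1 <= B + e2 - (e3 + e4) -> e1 <= 2 * r * n1 -> e2 <= n2 * (2 * l * r) ->
  - e3 <= 2 * r * n3 -> - e4 <= 2 * r * (2 * l * r) ->
  A <= B + (2 * n1 + 2 * l * n2 + 2 * n3 + 4 * l) * r.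
Proof.
move=> l0 r0 r1; have : 0 <= l * r * (1 - r) by rewrite !mulr_ge0 ?subr_ge0.
lra.
Qed.

(** The subgradient inequality does not involve the offset, so it is inherited from [x2]; only the
    bound on TV at [x2 - x1] needs the discrete approximation, with [r] tending to [0]. *)
Lemma optimal_nested (lam lam' : R) y x1 x2 : 0 < lam -> lam <= lam' -> inL2 y ->
  optimal lam y (fun=> 0) x1 -> optimal lam' y (fun=> 0) x2 ->
  optimal lam' y x1 x2.
Proof.
move=> lam0 ll iy o1 o2; have lam'0 := lt_le_trans lam0 ll.
have [ix1 _ _] := o1; have [ix2 s2 _] := o2.
split=> // psi apsi; have ipsi := admissible_inL2 apsi.
have i21 := inL2B ix2 ix1; have iyx := inL2B iy ix2.
pose v := lam' \*o (y \- x2); have iv : inL2 v by exact: inL2Z.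
rewrite -(ipZl _ iyx i21) -/v (ipC v).
pose N u := Num.sqrt (ip u u).
have N0 u : 0 <= N u by exact: sqrtr_ge0.
have NE u : ip u u <= N u ^+ 2 by rewrite sqr_sqrtr// ip_ge0.
apply: (@le_of_linear_error _ _
  (2 * N (derive1 psi) + 2 * lam' * N (x2 \- x1) + 2 * N v + 4 * lam')) => r r0 r1.
have a20 : 0 < lam'^-1 by rewrite invr_gt0.
have a12 : lam'^-1 <= lam^-1 by rewrite lef_pV2.
have [X1 [X2 [phi1 [phi2 [[iX1 iX2 ad1 ad2] [T1 T2 T12] c1 c2]]]]] :=
  nested_approximation iy a20 a12 r0.
have e1 := optimal_stable lam0 iy iX1 (ltW r0) o1 ad1 T1 c1.
have e2 := optimal_stable lam'0 iy iX2 (ltW r0) o2 ad2 T2 c2.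
have iphi := admissible_inL2 ad2.
have iX := inL2B iX2 iX1.
(* [E] is the primal error, with [X2 - X1 = (x2 - x1) - E]; each of its two parts has norm at most
   [r]. *)
pose E := (x2 \- X2) \- (x1 \- X1).
have i1 := inL2B ix1 iX1; have i2 := inL2B ix2 iX2.
have iE : inL2 E by exact: inL2B.
have EE : ip E E <= (2 * r) ^+ 2.
  by rewrite [2 * r]mulr_natl mulr2n; apply: ip_sub_le => //; exact: ltW.
pose d := y \- (X2 \+ (lam'^-1 \*o derive1 phi2)).
have id_ : inL2 d by apply: inL2B => //; apply: inL2D => //; exact: inL2Z.
(* [G] is the dual error: it is [lam'] times the difference of the primal error of [x2] and the data
   error [d], hence the bound [2 * lam' * r]. *)
pose G := derive1 phi2 \- v.
have iG : inL2 G by exact: inL2B.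
have GE : G = lam' \*o ((x2 \- X2) \- d).
  apply/funext => t; rewrite /G /v /d /=; field.
  by rewrite gt_eqF.
have i2d := inL2B i2 id_.
have GG : ip G G <= (2 * lam' * r) ^+ 2.
  have h : ip ((x2 \- X2) \- d) ((x2 \- X2) \- d) <= (2 * r) ^+ 2.
    by rewrite [2 * r]mulr_natl mulr2n; apply: ip_sub_le => //; exact: ltW.
  rewrite GE ipZl// ?ipZr//; last exact: inL2Z.
  by rewrite (mulrC 2) -mulrA exprMn mulrA -expr2 ler_wpM2l// sqr_ge0.
have r20 : 0 <= 2 * r by rewrite mulr_ge0// ltW.
have lr0 : 0 <= 2 * lam' * r by rewrite mulr_ge0 ?mulr_ge0// ltW.
have b1 := ip_small iE ipsi r20 (N0 _) EE (NE _).
have b2 := ip_small i21 iG (N0 _) lr0 (NE _) GG.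
have b3 := ip_small iE iv r20 (N0 _) EE (NE _).
have b4 := ip_small iE iG r20 lr0 EE GG.
have XE : X2 \- X1 = (x2 \- x1) \- E by apply/funext => t; rewrite /E /=; ring.
have phiE : derive1 phi2 = v \+ G by apply/funext => t; rewrite /G /=; ring.
have := T12 _ apsi.
rewrite XE (ipBl i21 iE ipsi) (ipBl i21 iE iphi) phiE.
rewrite (ipDr iv iG i21) (ipDr iv iG iE) => main.
apply: (error_budget (ltW lam'0) (ltW r0) r1 main).
- exact: le_trans (ler_norm _) b1.
- exact: le_trans (ler_norm _) b2.
- by rewrite -normrN in b3; exact: le_trans (ler_norm _) b3.
- by rewrite -normrN in b4; exact: le_trans (ler_norm _) b4.
Qed.

End nested.

(** Induction on [k]: [optimal_nested] makes [xl k.+1] optimal for the offset [xl k], which agrees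
    in L2 with [xs k], and [optimal_unique] identifies it with [xs k.+1]. *)
Theorem mainTheorem19 (R : realType) (y : R -> R) (lam : nat -> R)
  (xs : nat -> R -> R) (xl : nat -> R -> R) :
  inL2 y ->
  (forall k, 0 < lam k) ->
  (forall k, lam k <= lam k.+1) ->
  (* MHDM iterates *)
  is_minimizer (lam 0%N) y (fun _ => 0) (xs 0%N) ->
  (forall k, is_minimizer (lam k.+1) y (xs k) (xs k.+1)) ->
  (* TV-denoising minimizers x_{lam k} *)
  (forall k, is_minimizer (lam k) y (fun _ => 0) (xl k)) ->
  forall k, {ae (@lebesgue_measure R), forall t, I01 t -> xs k t = xl k t}.
Proof.
move=> iy lam0 lamS xs0 xsS xlP k.
have oxl i : optimal (lam i) y (fun=> 0) (xl i).
  by apply: minimizer_optimal => //; exact: inL2_0.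
have ixl i : inL2 (xl i) by have [] := oxl i.
have ixs i : inL2 (xs i) by case: i => [|i]; [have [] := xs0|have [] := xsS i].
have oxs i : optimal (lam i.+1) y (xs i) (xs i.+1) by exact: minimizer_optimal.
have eq0 : ip (xs k \- xl k) (xs k \- xl k) = 0.
  elim: k => [|k IH].
    apply: (optimal_unique (lam0 0%N) iy (@inL2_0 R) (@inL2_0 R)) => //.
      have i0 : inL2 ((fun=> 0 : R) \- (fun=> 0)) by apply: inL2B; exact: inL2_0.
      rewrite (_ : _ \- _ = fun=> 0); first exact: ip_0l.
      by apply/funext => t /=; rewrite subrr.
    by apply: minimizer_optimal => //; exact: inL2_0.
  apply: (optimal_unique (lam0 k.+1) iy (ixs k) (ixl k) IH) => //.
  exact: (optimal_nested (lam0 k)).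
have := ip_eq0_ae (inL2B (ixs k) (ixl k)) eq0.
apply: filterS; first exact: (ae_filter_ringOfSetsType (@lebesgue_measure R)).
by move=> t h It; apply/eqP; rewrite -subr_eq0; apply/eqP; exact: h.
Qed.
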